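(* Let $E$ be a smooth and strictly convex complex Banach space. If $A$ is a bounded hermitian operator on $\mathcal{B}_0(\triangle,E)$, then there exists a bounded hermitian operator $V$ on $E$ such that \[ A(f)(z)=V(f(z))\quad\text{for all } f\in\mathcal{B}_0(\triangle,E)\text{ and all } z\in\triangle.\]
   Context: $\triangle=\{z\in\mathbb{C}:|z|<1\}$. $\mathcal{B}_0(\triangle,E)$ is the Banach space of all analytic functions $f:\triangle\to E$ with $f(0)=0$ and $\lim_{|z|\to1}(1-|z|^2)\|f'(z)\|_E=0$, with norm $\|f\|=\sup_{z\in\triangle}(1-|z|^2)\|f'(z)\|_E$. An operator $A$ on a complex Banach space is hermitian if $iA$ is the generator of a strongly continuous one-parameter group (indexed by $\mathbb{R}$) of surjective linear isometries; for bounded $A$ this means that $e^{itA}$ is a surjective isometry for every $t\in\mathbb{R}$. *)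

(* Defs.v *)
From HB Require Import structures.
From mathcomp Require Import all_boot all_order all_algebra.
From mathcomp Require Import complex ring lra.
From mathcomp Require Import all_classical all_reals all_analysis.
Import Order.TTheory GRing.Theory Num.Theory.
Import ComplexField numFieldNormedType.Exports.

Set Implicit Arguments.
Unset Strict Implicit.
Unset Printing Implicit Defensive.

Local Open Scope classical_set_scope.
Local Open Scope complex_scope.
Local Open Scope ring_scope.

(* Norms over the complex field R[i] take their values in R[i]; [Re] brings
   them back to R whenever a supremum or a limit in R is needed. *)

Section Geometry.
Context {R : realType}.
Implicit Types E : normedModType R[i].

(* At a unit vector x these two conditions force the dual norm of phi to be
   exactly 1. *)
Definition support_functional E (x : E) (phi : {scalar E}) : Prop :=
  (forall y, `|phi y| <= `|y|) /\ phi x = `|x|.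

Definition smooth_space E : Prop :=
  forall x : E, `|x| = 1 ->
    exists phi : {scalar E}, support_functional x phi /\
      forall psi : {scalar E}, support_functional x psi -> psi =1 phi.

Definition strictly_convex_space E : Prop :=
  forall x y : E, `|x| = 1 -> `|y| = 1 -> x != y ->
    `|2^-1 *: (x + y)| < 1.

End Geometry.

Section Hermitian.
Context {R : realType}.
Implicit Types X : normedModType R[i].

Record c0_isometry_group X (U : R -> X -> X) : Prop := {
  c0_linear : forall t, linear (U t);
  c0_isometry : forall t x, `|U t x| = `|x|;
  c0_surjective : forall t y, exists x, U t x = y;
  c0_id : forall x, U 0 x = x;
  c0_add : forall s t x, U (s + t) x = U s (U t x);
  c0_continuous : forall x, continuous (fun t => U t x)
}.

(* The generator of U when its domain is the whole space. *)
Definition generates X (U : R -> X -> X) (G : X -> X) : Prop :=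
  forall x, (h^-1)%:C *: (U h x - x) @[h --> (0 : R)^'] --> G x.

(* A is everywhere defined, so iA has domain X: the limit defining the generator
   must exist at every point. *)
Definition hermitian_operator X (A : {linear X -> X}) : Prop :=
  exists2 U : R -> X -> X,
    c0_isometry_group U & generates U (fun x => 'i *: A x).

Definition bounded_operator X (A : {linear X -> X}) : Prop :=
  exists M : R, forall x, `|A x| <= M%:C * `|x|.

End Hermitian.

Section LittleBloch.
Context {R : realType}.
Implicit Types E : normedModType R[i].

Definition disk : set R[i] := [set z | `|z| < 1].

(* The filter "|z| -> 1 with z in the disk". *)
Definition to_circle : set_system R[i] :=
  filter_from [set r : R | r < 1] (fun r => [set z | r%:C < `|z| < 1]).

#[global] Instance to_circle_filter : ProperFilter to_circle.
Proof.
apply: filter_from_proper => [|r /= r1].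
  apply: filter_from_filter => [|r s /= r1 s1]; first by exists 0; exact: ltr01.
  exists (Num.max r s); first by rewrite /= gt_max r1 s1.
  move=> z /= /andP[+ z1]; rewrite -(RRe_real (normr_real z)) !ltcR gt_max.
  by case/andP=> rz sz; rewrite rz sz -ltcR (RRe_real (normr_real z)) z1.
have h0 : 0 <= Num.max r 0 by rewrite le_max lexx orbT.
have h1 : Num.max r 0 < 1 by rewrite gt_max r1 ltr01.
exists ((Num.max r 0 + 1) / 2)%:C => /=.
have -> : `|((Num.max r 0 + 1) / 2)%:C| = ((Num.max r 0 + 1) / 2)%:C :> R[i].
  by rewrite ger0_norm// ler0c divr_ge0// addr_ge0// ler01.
rewrite ltcR (ltcR _ 1).
by apply/andP; split; [apply: (@le_lt_trans _ _ (Num.max r 0));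
  [by rewrite le_max lexx|lra]|lra].
Qed.

Definition bloch_weight E (f : R[i] -> E) (z : R[i]) : R :=
  complex.Re ((1 - `|z| ^+ 2) * `|derive1 f z|).

(* A function on the disk is represented by its extension by 0 to the plane, so
   that Leibniz equality is equality on the disk.
   The clause [lb_bounded] is a consequence of the others (f' is continuous and
   the weight vanishes at the circle); it gives finiteness of the supremum
   [bloch_norm] without first developing Cauchy's theory. *)
Record is_little_bloch E (f : R[i] -> E) : Prop := {
  lb_out : forall z, ~ disk z -> f z = 0;
  lb_analytic : forall z, disk z -> derivable (f : R[i]^o -> E) z 1;
  lb_0 : f 0 = 0;
  lb_bounded : exists M : R, forall z, disk z -> bloch_weight f z <= M;
  lb_vanish : bloch_weight f @ to_circle --> (0 : R)
}.

Lemma bloch_weightE E (f : R[i] -> E) z :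
  (bloch_weight f z)%:C = (1 - `|z| ^+ 2) * `|derive1 f z|.
Proof. by rewrite RRe_real// rpredM ?rpredB ?rpredX ?normr_real ?rpred1. Qed.

Lemma disk_weight_gt0 (z : R[i]) : disk z -> 0 < 1 - `|z| ^+ 2.
Proof. by move=> z1; rewrite subr_gt0 exprn_ilt1. Qed.

Lemma bloch_weight_ge0 E (f : R[i] -> E) z : disk z -> 0 <= bloch_weight f z.
Proof.
by move=> z1; rewrite -ler0c bloch_weightE mulr_ge0// ltW// disk_weight_gt0.
Qed.

Lemma bloch_weightD E (f g : R[i] -> E) z : disk z ->
  derivable (f : R[i]^o -> E) z 1 -> derivable (g : R[i]^o -> E) z 1 ->
  bloch_weight (f + g) z <= bloch_weight f z + bloch_weight g z.
Proof.
move=> z1 df dg; rewrite -lecR rmorphD/= !bloch_weightE !derive1E.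
rewrite (deriveD df dg) -mulrDr ler_wpM2l ?ler_normD//.
by rewrite ltW// disk_weight_gt0.
Qed.

Lemma bloch_weightZ E (k : R[i]) (f : R[i] -> E) z :
  derivable (f : R[i]^o -> E) z 1 ->
  bloch_weight (k *: f) z = complex.Re `|k| * bloch_weight f z.
Proof.
move=> df; apply: complexI; rewrite rmorphM/= (RRe_real (normr_real k)).
by rewrite !bloch_weightE !derive1E (deriveZ k df) normrZ mulrCA.
Qed.

Section Submodule.
Variable E : normedModType R[i].

Definition little_bloch : {pred R[i] -> E} :=
  [pred f | `[< is_little_bloch f >]].

Lemma little_blochP f : reflect (is_little_bloch f) (f \in little_bloch).
Proof. exact: asboolP. Qed.

Lemma little_bloch_submod : submod_closed little_bloch.
Proof.
have d0 z : derivable ((0 : R[i] -> E) : R[i]^o -> E) z 1.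
  exact: derivable_cst.
have w0 z : bloch_weight (0 : R[i] -> E) z = 0.
  by apply: complexI; rewrite bloch_weightE derive1E derive_cst normr0 mulr0.
have dsk : \forall z \near to_circle, disk z.
  by exists 0; [exact: ltr01|move=> z /= /andP[]].
split; [apply/little_blochP|move=> k f g].
  split=> //; first by exists 0 => z _; rewrite w0.
  by rewrite (_ : bloch_weight _ = cst 0); [exact: cvg_cst|exact/funext].
move=> /little_blochP[f1 f2 f3 [Mf f4] f5] /little_blochP[g1 g2 g3 [Mg g4] g5].
have dk z : disk z -> derivable ((k *: f) : R[i]^o -> E) z 1.
  by move=> /f2; exact: derivableZ.
have le z : disk z -> bloch_weight (k *: f + g) z <=
    complex.Re `|k| * bloch_weight f z + bloch_weight g z.
  move=> z1; rewrite -(bloch_weightZ k (f2 z z1)).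
  exact: bloch_weightD (dk z z1) (g2 z z1).
apply/little_blochP; split.
- move=> z nz; rewrite -[LHS]/(k *: f z + g z).
  by rewrite f1// g1// scaler0 addr0.
- by move=> z z1; apply: derivableD; [exact: dk|exact: g2].
- by rewrite -[LHS]/(k *: f 0 + g 0) f3 g3 scaler0 addr0.
- exists (complex.Re `|k| * Mf + Mg) => z z1; rewrite (le_trans (le z z1))//.
  rewrite lerD ?g4// ler_wpM2l ?f4//.
  by rewrite -ler0c (RRe_real (normr_real k)).
- apply: (squeeze_cvgr (f := cst 0)
    (h := fun z => complex.Re `|k| * bloch_weight f z + bloch_weight g z)).
  + near=> z; rewrite bloch_weight_ge0 ?le//; near: z; exact: dsk.
  + exact: cvg_cst.
  + rewrite -[X in _ --> X]addr0 -[X in _ --> X + _](mulr0 (complex.Re `|k|)).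
    apply: cvgD => //; apply: cvgM => //; exact: cvg_cst.
Unshelve. all: by end_near. Qed.

HB.instance Definition _ :=
  GRing.isSubmodClosed.Build R[i] (R[i] -> E) little_bloch little_bloch_submod.

End Submodule.

Record B0 E := MkB0 {
  B0_val :> R[i] -> E;
  B0_valP : B0_val \in little_bloch (E := E)
}.

Section Space.
Variable E : normedModType R[i].

HB.instance Definition _ := [isSub for @B0_val E].
HB.instance Definition _ := [Choice of B0 E by <:].
HB.instance Definition _ := [SubChoice_isSubLmodule of B0 E by <:].

Implicit Types f g : B0 E.

Lemma B0P f : is_little_bloch f.
Proof. exact/little_blochP/B0_valP. Qed.

Definition bloch_norm f : R := sup [set bloch_weight f z | z in disk].

Lemma disk0 : disk 0.
Proof. by rewrite /disk/= normr0 ltr01. Qed.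

Lemma bloch_weight_le f z : disk z -> bloch_weight f z <= bloch_norm f.
Proof.
move=> z1; have [M fM] := lb_bounded (B0P f).
by apply: ub_le_sup; [exists M => _ [w w1 <-]; exact: fM|exists z].
Qed.

Lemma bloch_norm_le f (M : R) :
  (forall z, disk z -> bloch_weight f z <= M) -> bloch_norm f <= M.
Proof.
move=> fM; apply: ge_sup.
  by exists (bloch_weight f 0); exists 0 => //; exact: disk0.
by move=> _ [z z1 <-]; exact: fM.
Qed.

Lemma bloch_norm_ge0 f : 0 <= bloch_norm f.
Proof.
exact: le_trans (bloch_weight_ge0 f disk0) (bloch_weight_le f disk0).
Qed.

Lemma bloch_normD f g : bloch_norm (f + g) <= bloch_norm f + bloch_norm g.
Proof.
apply: bloch_norm_le => z z1.
apply: (le_trans (bloch_weightD z1 (lb_analytic (B0P f) z1)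
  (lb_analytic (B0P g) z1))).
by rewrite lerD// bloch_weight_le.
Qed.

Lemma bloch_normZ_le (k : R[i]) f :
  bloch_norm (k *: f) <= complex.Re `|k| * bloch_norm f.
Proof.
apply: bloch_norm_le => z z1.
rewrite (bloch_weightZ k (lb_analytic (B0P f) z1)) ler_wpM2l ?bloch_weight_le//.
by rewrite -ler0c (RRe_real (normr_real k)).
Qed.

Lemma bloch_normZ (k : R[i]) f :
  bloch_norm (k *: f) = complex.Re `|k| * bloch_norm f.
Proof.
apply/eqP; rewrite eq_le bloch_normZ_le andTb.
have [->|k0] := eqVneq k 0; first by rewrite normr0 mul0r bloch_norm_ge0.
have kE := RRe_real (normr_real k).
have kp : 0 < complex.Re `|k| by rewrite -(ltcR 0) kE normr_gt0.
have := bloch_normZ_le k^-1 (k *: f).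
rewrite scalerA mulVf// scale1r.
have -> : complex.Re `|k^-1| = (complex.Re `|k|)^-1.
  by apply: complexI; rewrite (RRe_real (normr_real _)) normfV -kE fmorphV.
by rewrite mulrC ler_pdivlMr// mulrC.
Qed.

Lemma derive1_0_cst (f : R[i] -> E) :
  (forall z, disk z -> derivable (f : R[i]^o -> E) z 1) ->
  (forall z, disk z -> derive1 f z = 0) -> forall z, disk z -> f z = f 0.
Proof.
move=> df f'0 z z1; have [->//|z0] := eqVneq z 0.
pose g (t : R) : R := complex.Re `|f (t%:C * z) - f 0|.
pose n := complex.Re `|z|.
have nE : n%:C = `|z| by exact: RRe_real (normr_real z).
have n0 : 0 < n by rewrite -(ltcR 0) nE normr_gt0.
have n1 : n < 1 by rewrite -(ltcR _ 1) nE.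
have gE t : (g t)%:C = `|f (t%:C * z) - f 0| by exact: RRe_real (normr_real _).
have nC (r : R) : `|r%:C| = `|r|%:C :> R[i].
  by rewrite normc_def/= expr0n addr0 sqrtr_sqr.
have tz t : `|t| <= 1 -> disk (t%:C * z).
  move=> t1; rewrite /disk/= normrM nC -nE -rmorphM (ltcR _ 1).
  by rewrite (le_lt_trans _ n1)// ler_piMl// ltW.
have dg t : `|t| <= 1 -> is_derive t (1 : R) g 0.
  move=> t1; have dz := tz t t1.
  have h0 : (fun h : R => h^-1 *: ((g \o shift t) (h *: 1) - g t)) @ 0^'
      --> (0 : R).
    apply/cvgrPdist_le => e e0.
    have en0 : 0 < (e / n)%:C :> R[i] by rewrite (ltcR 0) divr_gt0.
    have := df _ dz; rewrite /derivable -/(derive (f : R[i]^o -> E) _ 1).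
    rewrite -derive1E f'0// => /cvgrPdist_le /(_ _ en0).
    case=> d /= d0 Hd.
    have dE : (complex.Re d)%:C = d by exact: RRe_real (gtr0_real d0).
    have d0' : 0 < complex.Re d by rewrite -(ltcR 0) dE.
    near=> h.
    have hN0 : h != 0 by near: h; exact: nbhs_dnbhs_neq.
    have hd : `|h| < complex.Re d / n.
      by near: h; apply: dnbhs0_lt; rewrite divr_gt0.
    have hz0 : h%:C * z != 0.
      by rewrite mulf_neq0// (fmorph_eq0 (real_complex R)).
    have hzE : `|h%:C * z| = (`|h| * n)%:C by rewrite normrM nC -nE rmorphM.
    have inb : ball_ [eta Num.Def.normr] 0 d (h%:C * z).
      by rewrite /ball_/= sub0r normrN hzE -dE ltcR -ltr_pdivlMr.
    have := Hd _ inb hz0.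
    rewrite sub0r normrN [(h%:C * z)%:A](mulr1) -mulrDl -rmorphD/=.
    rewrite normrZ normfV hzE => HD.
    have hn0 : 0 < (`|h| * n)%:C :> R[i].
      by rewrite (ltcR 0) mulr_gt0// normr_gt0.
    rewrite mulrC ler_pdivrMr// -rmorphM/= in HD.
    have eE : e / n * (`|h| * n) = e * `|h| by field; rewrite gt_eqF.
    rewrite eE in HD.
    have gD : `|g (h + t) - g t| <= e * `|h|.
      rewrite -lecR; apply: le_trans HD; rewrite -nC rmorphB/= !gE.
      apply: (le_trans (ler_dist_dist _ _)).
      by rewrite opprB addrA subrK.
    rewrite sub0r normrN [h%:A](mulr1) normrZ normfV mulrC.
    by rewrite ler_pdivrMr// normr_gt0.
  apply: DeriveDef; first by apply/cvg_ex; exists 0.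
  exact: cvg_lim h0.
have [||c _] := @MVT_segment R g (cst 0) 0 1 ler01.
- move=> x; rewrite in_itv/= => /andP[x0 x1].
  by apply: dg; rewrite ger0_norm ltW.
- apply: derivable_within_continuous => x; rewrite in_itv/= => /andP[x0 x1].
  by have [] := dg x (ltac:(by rewrite ger0_norm)).
rewrite mul0r => /eqP; rewrite subr_eq0 => /eqP g1.
have := gE 1.
rewrite g1 gE rmorph0 rmorph1 mul0r mul1r subrr normr0 => /esym/eqP.
by rewrite normr_eq0 subr_eq0 => /eqP.
Unshelve. all: by end_near. Qed.

Lemma bloch_norm_eq0 f : bloch_norm f = 0 -> f = 0.
Proof.
move=> f0; apply/val_inj/funext => z /=; have Pf := B0P f.
have [z1|/(lb_out Pf)//] := pselect (disk z).
rewrite -[RHS](lb_0 Pf).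
apply: derive1_0_cst z1 => [w|w w1]; first exact: lb_analytic.
have : bloch_weight f w = 0.
  by apply/eqP; rewrite eq_le bloch_weight_ge0// andbT -f0 bloch_weight_le.
move=> /(congr1 (real_complex R)); rewrite bloch_weightE rmorph0 => /eqP.
by rewrite mulf_eq0 (gt_eqF (disk_weight_gt0 w1))/= normr_eq0 => /eqP.
Qed.

Let normD f g :
  (bloch_norm (f + g))%:C <= (bloch_norm f)%:C + (bloch_norm g)%:C.
Proof. by rewrite -rmorphD lecR bloch_normD. Qed.

Let normZ (k : R[i]) f : (bloch_norm (k *: f))%:C = `|k| * (bloch_norm f)%:C.
Proof. by rewrite bloch_normZ rmorphM/= (RRe_real (normr_real k)). Qed.

Let norm_eq0 f : (bloch_norm f)%:C = 0 -> f = 0.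
Proof. by move=> /complexI; exact: bloch_norm_eq0. Qed.

HB.instance Definition _ :=
  Lmodule_isNormed.Build R[i] (B0 E) normD normZ norm_eq0.

End Space.
End LittleBloch.

(* Main.v *)
From HB Require Import structures.
Require Import Defs.
From mathcomp Require Import all_boot all_order all_algebra.
From mathcomp Require Import complex ring lra.
From mathcomp Require Import all_classical all_reals all_analysis.
Import Order.TTheory GRing.Theory Num.Theory.
Import ComplexField numFieldNormedType.Exports.

Set Implicit Arguments.
Unset Strict Implicit.
Unset Printing Implicit Defensive.

Local Open Scope classical_set_scope.
Local Open Scope ring_scope.
Local Open Scope complex_scope.

(** Write D_w f for f'(w), the derivative at a point w of the disk, and let U_t
be the isometry group generated by iA.

Suppose that f attains its norm at w: (1 - |w|^2) phi(f'(w)) = ||f|| for a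
functional phi with |phi(y)| <= |y|.  Then t |-> Re phi(D_w (U_t f)) is
maximal at t = 0, so its derivative vanishes there, which says that
phi(D_w (A f)) is real ([peaking_numerical_real]).  The function with
derivative (1 - conj(w) z)^-2 x attains its norm at w with a quadratic margin,
by the identity
  |1 - conj(w) z|^2 = |z - w|^2 + (1 - |z|^2) (1 - |w|^2),
so it still does after a small multiple of i g is added to it, as soon as
(1 - |z|^2) |g'(z)| = O(|z - w|^2).  With x = D_w (A g) this forces
D_w (A g) = 0 ([derivative_kernel]).  Subtracting from f the terms that carry
f'(w) and f''(w) gives
  D_w (A f) = L_w (f'(w)) + M_w (f''(w))
([first_order]).  A term with f'' is incompatible with boundedness: the
monomials z^n y show that |M_w y| tends to 0 when |w| runs through a sequence of
radii tending to 1, and M_w y is holomorphic in w, so M = 0 by Cauchy's estimate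
([derivative_symbol_eq0]).

It remains to see that L_w is independent of w.  As D_w (A f) = L_w (D_w f), the
curve t |-> D_w (U_t f) solves a linear differential equation in E, hence it
stays 0 when D_w f = 0, and D_w (U_t f) = e_t(w) (D_w f) for some operator
e_t(w).  The peaking functions show that e_t(w) is isometric
([group_isometry]).  So w |-> e_t(w) x is a holomorphic function of constant
norm; in a strictly convex space such a function is constant
([holomorphic_cst_norm]).  Therefore U_t (z x) = z (u_t x) for an isometry group
u of E.  Its generator is iV with V x = D_0 (A (z x)), and D_w (A f) = V (D_w f)
for all w, which integrates to A f = V f.

The complex analysis behind this is Cauchy's formula for a function with values
in E that has a locally bounded complex derivative.  Smoothness provides a
norming functional for every vector, and with these functionals the formula
reduces to integrals of real functions over [0, 2 pi].  It is obtained by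
differentiating under the integral sign along the homotopy that shrinks a circle
to a point: the integrand becomes the derivative of a periodic function.
Completeness of E gives f''.  *)

(** * Integrals over one period *)

Section CircleIntegral.
Context {R : realType}.
Implicit Types (u : R -> R).

Local Notation mu := (@lebesgue_measure R).
Local Notation period := (2 * pi : R).

Definition circle_int u : R := \int[mu]_(x in `[0, 2 * pi]) u x.

Lemma period_gt0 : 0 < period.
Proof. by rewrite mulr_gt0// pi_gt0. Qed.

Lemma integrable_segment u (a b : R) :
  continuous u -> mu.-integrable `[a, b] (EFin \o u).
Proof.
move=> cu; apply: continuous_compact_integrable; first exact: segment_compact.
exact: continuous_subspaceT.
Qed.

Lemma measure_period : fine (mu `[0, period]) = period.
Proof.
by rewrite lebesgue_measure_itv/= lte_fin period_gt0 -EFinB/= subr0.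
Qed.

Lemma circle_int_cst (c : R) : circle_int (fun=> c) = c * period.
Proof. by rewrite /circle_int Rintegral_cst// measure_period. Qed.

Lemma circle_intD u v : continuous u -> continuous v ->
  circle_int (fun x => u x + v x) = circle_int u + circle_int v.
Proof. by move=> cu cv; apply: RintegralD => //; exact: integrable_segment. Qed.

Lemma circle_int_ub u (c : R) : continuous u ->
  (forall x, u x <= c) -> circle_int u <= c * period.
Proof.
move=> cu uc; rewrite -circle_int_cst; apply: le_Rintegral => //.
  exact: integrable_segment.
by apply: integrable_segment; exact: cst_continuous.
Qed.

Lemma is_derive_continuous u du :
  (forall x, is_derive x (1 : R) u (du x)) -> continuous u.
Proof.
by move=> h x; apply/differentiable_continuous/derivable1_diffP; have [] := h x.
Qed.

Lemma circle_int_diff (f df : R -> R -> R) (a e M : R) : 0 < e ->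
  (forall t, `|t - a| < e -> continuous (f t)) ->
  (forall t x, `|t - a| < e -> is_derive t (1 : R) (f ^~ x) (df t x)) ->
  (forall t x, `|t - a| < e -> `|df t x| <= M) ->
  is_derive a (1 : R) (fun t => circle_int (f t)) (circle_int (df a)).
Proof.
move=> e0 cf dfP dfM.
have inI t : t \in `](a - e), (a + e)[ -> `|t - a| < e.
  by rewrite in_itv/= ltr_distl.
have aI : `](a - e), (a + e)[%classic a.
  by rewrite /= in_itv/= ltrBlDr ltrDl e0.
have intf x : `](a - e), (a + e)[%classic x ->
    mu.-integrable `[0, period] (EFin \o f x).
  by move=> /inI xa; apply: integrable_segment; exact: cf.
have derf x y : `](a - e), (a + e)[%classic x -> `[0, period]%classic y ->
    derivable (f ^~ y) x 1.
  by move=> /inI xa _; have [] := dfP x y xa.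
have M0 : 0 <= M.
  by rewrite (le_trans _ (dfM a 0 _))// subrr normr0.
have dfE x y : `|x - a| < e -> partial1of2 f x y = df x y.
  by move=> xa; rewrite partial1of2E; have [_] := dfP x y xa.
have G_ub x y : `](a - e), (a + e)[%classic x -> `[0, period]%classic y ->
    `|partial1of2 f x y| <= M.
  by move=> /inI xa _; rewrite dfE//; exact: dfM.
have iM : mu.-integrable `[0, period] (EFin \o (cst M : R -> R)).
  by apply: integrable_segment; exact: cst_continuous.
apply: DeriveDef.
  by apply: (@derivable_under_integral _ _ _ mu _ _ _ _ _ _ aI intf derf
    (cst M) _ iM G_ub).
rewrite -derive1E (@differentiation_under_integral _ _ _ mu _ _ _ _ _ _ aI intf
  derf (cst M) _ iM G_ub)//.
by apply: eq_Rintegral => x _; rewrite dfE ?inI//.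
Qed.

Lemma has_primitive u (b : R) : continuous u ->
  exists P : R -> R, forall x, `|x| < b -> is_derive x (1 : R) P (u x).
Proof.
move=> cu; exists (fun x => \int[mu]_(t in `[-b, x]) u t).
move=> x; rewrite ltr_norml => /andP[bx xb].
have [|dP PE] := @continuous_FTC1 R u (BLeft (- b)) x b xb
  (@integrable_segment u _ _ cu) _ (cu x).
  by rewrite /= lte_fin.
by apply: DeriveDef; rewrite -?derive1E.
Qed.

Lemma is_derive_shiftl (a x : R) : is_derive x (1 : R) (fun y => a + y) (1 : R).
Proof. by have := is_deriveD (is_derive_cst a x 1) (is_derive_id x 1); rewrite add0r. Qed.

(** The shift by s is absorbed in the primitive, so that the dependence on s is
    explicit. *)
Lemma circle_int_deriv u (P : R -> R) (s b : R) : 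
  continuous u -> period + `|s| < b ->
  (forall x, `|x| < b -> is_derive x (1 : R) P (u x)) ->
  circle_int (fun x => u (x + s)) = P (period + s) - P s.
Proof.
move=> cu sb dP.
have dQ x : 0 <= x <= period ->
    is_derive x (1 : R) (fun y => P (y + s)) (u (x + s)).
  move=> /andP[x0 x1].
  have xs : `|x + s| < b.
    by rewrite (le_lt_trans (ler_normD _ _))// (le_lt_trans _ sb)// ger0_norm ?lerD.
  have h1 := dP _ xs.
  have h2 : is_derive x (1 : R) (fun y => y + s) (1 : R).
    by apply: is_derive_eq; rewrite addr0.
  by have := @is_derive1_comp R P (fun y => y + s) x _ _ h1 h2; rewrite mulr1.
have cQ x : 0 <= x <= period -> {for x, continuous (fun y => P (y + s))}.
  move=> hx; apply/differentiable_continuous/derivable1_diffP.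
  by have [] := dQ x hx.
rewrite /circle_int /Rintegral (@continuous_FTC2 _ _ (fun y => P (y + s))) ?period_gt0//.
- by rewrite -EFinB/= add0r.
- apply: continuous_subspaceT => x; apply: continuous_comp; last exact: cu.
  by apply: cvgD; [exact: cvg_id|exact: cvg_cst].
- split.
  + move=> x; rewrite in_itv/= => /andP[x0 x1].
    by have [] := dQ x (ltac:(by rewrite !ltW)).
  + apply: cvg_at_right_filter; apply: cQ; by rewrite lexx ltW ?period_gt0.
  + apply: cvg_at_left_filter; apply: cQ; by rewrite lexx ltW ?period_gt0.
- move=> x; rewrite in_itv/= => /andP[x0 x1].
  by rewrite derive1E; have [_] := dQ x (ltac:(by rewrite !ltW)).
Qed.

(** The derivative du is only bounded, so the fundamental theorem of calculus
    is not applied to it.  Instead the integral of u (x + s) over a period is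
    differentiated at s = 0 in two ways: under the integral sign, and as
    P (2 pi + s) - P s for a primitive P of the continuous function u. *)
Lemma circle_int_periodic_derive u du (M : R) :
  (forall x, is_derive x (1 : R) u (du x)) ->
  (forall x, `|du x| <= M) -> (forall x, u (x + period) = u x) ->
  circle_int du = 0.
Proof.
move=> dP duM uper.
have cu : continuous u by exact: is_derive_continuous.
have [P PP] := has_primitive (period + 1 + 1) cu.
have d1 : is_derive 0 (1 : R) (fun s => circle_int (fun x => u (x + s)))
    (circle_int du).
  rewrite [X in circle_int X](_ : _ = (fun x => du (x + 0))); last first.
    by apply/funext => x; rewrite addr0.
  apply: (@circle_int_diff (fun s x => u (x + s)) (fun s x => du (x + s)) 0 1 M).
  - exact: ltr01.
  - move=> t _ x; apply: continuous_comp; last exact: cu.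
    by apply: cvgD; [exact: cvg_id|exact: cvg_cst].
  - move=> t x _.
    have h2 := is_derive_shiftl x t.
    by have := @is_derive1_comp R u (fun y => x + y) t _ _ (dP (x + t)) h2; rewrite mulr1.
  - by move=> *; exact: duM.
have d2 : is_derive 0 (1 : R) (fun s => P (period + s) - P s) (0 : R).
  have h2 := is_derive_shiftl period 0.
  have h3 : is_derive (period + 0) (1 : R) P (u (period + 0)).
    apply: PP; rewrite addr0 ger0_norm ?ltW ?period_gt0//.
    by rewrite -addrA ltrDl.
  have h4 : is_derive (0 : R) (1 : R) P (u 0).
    by apply: PP; rewrite normr0 !addr_gt0// period_gt0.
  have := is_deriveB (@is_derive1_comp R P (fun y => period + y) 0 _ _ h3 h2) h4.
  by rewrite mulr1 (addrC period) uper subrr.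
have [_ <-] := d1; have [_ E] := d2; rewrite -[RHS]E.
apply: near_eq_derive.
near=> s; apply: (circle_int_deriv cu _ PP).
have s1 : `|s| < 1.
  by near: s; apply/nbhs_ballP; exists 1 => //= s; rewrite /ball/= sub0r normrN.
by rewrite -addrA ltrD2l (lt_trans s1)// ltrDl.
Unshelve. all: by end_near. Qed.

(** A primitive of u is nondecreasing with equal values at 0 and 2 pi. *)
Lemma circle_int_eq0 u : continuous u -> (forall x, 0 <= u x) ->
  circle_int u = 0 -> forall x, 0 < x < period -> u x = 0.
Proof.
move=> cu u0 Iu0 x /andP[x0 xp].
have [P PP] := has_primitive (period + 1) cu.
have inb y : 0 <= y <= period -> `|y| < period + 1.
  move=> /andP[y0 yp]; rewrite ger0_norm// (le_lt_trans yp)// ltrDl//.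
have P0 : P period = P 0.
  have := @circle_int_deriv u P 0 (period + 1) cu.
  rewrite normr0 addr0 ltrDl ltr01 => /(_ isT PP).
  under eq_fun do rewrite addr0.
  by rewrite Iu0 => /esym/eqP; rewrite subr_eq0 => /eqP.
have Pinc y z : 0 <= y -> y <= z -> z <= period -> P y <= P z.
  move=> y0 yz zp.
  have cP : {within `[y, z], continuous P}.
    apply: derivable_within_continuous => c; rewrite in_itv/= => /andP[yc cz].
    by have [] := PP c (inb c (ltac:(by rewrite (le_trans y0)//= (le_trans cz)))).
  have [c|c] := @MVT_segment R P u y z yz _ cP.
    rewrite in_itv/= => /andP[yc cz]; apply: PP; apply: inb.
    by rewrite (le_trans y0 (ltW yc)) (le_trans (ltW cz) zp).
  by move=> _ /eqP; rewrite subr_eq => /eqP ->; rewrite lerDr mulr_ge0// subr_ge0.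
have Pc y : 0 <= y -> y <= period -> P y = P 0.
  move=> y0 yp; apply/eqP; by rewrite eq_le (Pinc 0 y)// andbT -P0 Pinc.
have xb : `|x| < period + 1 by apply: inb; rewrite !ltW.
have [_ E] := PP x xb; rewrite -[LHS]E -[RHS](@derive_cst R R R (P 0) x 1).
apply: near_eq_derive.
near=> y; apply: Pc.
- near: y; exact: lt_le_nbhsr x0.
- near: y; exact: lt_le_nbhsl xp.
Unshelve. all: by end_near. Qed.

End CircleIntegral.

(** * Real-valued norms, and derivatives along curves and in the complex plane *)

Section RealNorm.
Context {R : realType}.

(** Norms of spaces over R[i] are complex numbers with zero imaginary part;
    their real parts can be compared, integrated and used in linear
    arithmetic. *)
Definition rnorm (V : normedZmodType R[i]) (x : V) : R := complex.Re `|x|.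

Lemma rnormE (V : normedZmodType R[i]) (x : V) : (rnorm x)%:C = `|x|.
Proof. exact: RRe_real (normr_real x). Qed.

Section Zmod.
Context {V : normedZmodType R[i]}.
Implicit Types x y : V.

Lemma rnorm_ge0 x : 0 <= rnorm x.
Proof. by rewrite -ler0c rnormE. Qed.

Lemma rnorm0 : rnorm (0 : V) = 0.
Proof. by apply: complexI; rewrite rnormE normr0. Qed.

Lemma rnormN x : rnorm (- x) = rnorm x.
Proof. by rewrite /rnorm normrN. Qed.

Lemma rnormD x y : rnorm (x + y) <= rnorm x + rnorm y.
Proof. by rewrite -lecR rmorphD/= !rnormE ler_normD. Qed.

Lemma rnormB x y : rnorm (x - y) <= rnorm x + rnorm y.
Proof. by rewrite -(rnormN y) rnormD. Qed.

Lemma rnorm_eq0 x : rnorm x = 0 -> x = 0.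
Proof.
by move=> h; apply/eqP; rewrite -normr_eq0 -rnormE h.
Qed.

Lemma rnorm_gt0 x : x != 0 -> 0 < rnorm x.
Proof. by move=> x0; rewrite -(ltcR 0) rnormE normr_gt0. Qed.

Lemma rnorm_le x (c : R) : (rnorm x <= c) = (`|x| <= c%:C).
Proof. by rewrite -lecR rnormE. Qed.

Lemma rnorm_lt x (c : R) : (rnorm x < c) = (`|x| < c%:C).
Proof. by rewrite -ltcR rnormE. Qed.

End Zmod.

Lemma rnormZ (V : normedModType R[i]) (a : R[i]) (x : V) :
  rnorm (a *: x) = rnorm a * rnorm x.
Proof. by apply: complexI; rewrite rmorphM/= !rnormE normrZ. Qed.

Lemma rnormM (a b : R[i]) : rnorm (a * b) = rnorm a * rnorm b.
Proof. by apply: complexI; rewrite rmorphM/= !rnormE normrM. Qed.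

Lemma rnormV (a : R[i]) : rnorm a^-1 = (rnorm a)^-1.
Proof. by apply: complexI; rewrite fmorphV/= !rnormE normfV. Qed.

Lemma rnormX (a : R[i]) n : rnorm (a ^+ n) = rnorm a ^+ n.
Proof. by apply: complexI; rewrite rmorphXn/= !rnormE normrX. Qed.

Lemma rnorm_real (a : R) : rnorm a%:C = `|a|.
Proof. by apply: complexI; rewrite rnormE normc_def/= expr0n addr0 sqrtr_sqr. Qed.

Lemma rnorm1 : rnorm (1 : R[i]) = 1.
Proof. by rewrite -[1]/(1%:C) rnorm_real normr1. Qed.

Lemma rnorm_nat n : rnorm (n%:R : R[i]) = n%:R.
Proof. by rewrite -(rmorph_nat (real_complex R)) rnorm_real ger0_norm. Qed.

Lemma rnorm_i : rnorm ('i : R[i]) = 1.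
Proof. by apply: complexI; rewrite rnormE normc_def/= expr0n/= expr1n add0r sqrtr1. Qed.

Lemma rnorm_sqr (z : R[i]) :
  rnorm z ^+ 2 = complex.Re z ^+ 2 + complex.Im z ^+ 2.
Proof. by apply: complexI; rewrite add_Re2_Im2 rmorphXn/= rnormE. Qed.

Lemma ler_Re_rnorm (z : R[i]) : `|complex.Re z| <= rnorm z.
Proof. by rewrite -lecR rnormE normc_ge_Re. Qed.

Lemma ReD (a b : R[i]) : complex.Re (a + b) = complex.Re a + complex.Re b.
Proof. by case: a b => [? ?] [? ?]. Qed.

Lemma ReN (a : R[i]) : complex.Re (- a) = - complex.Re a.
Proof. by case: a => [? ?]. Qed.

Lemma ReZ (r : R) (a : R[i]) : complex.Re (r%:C * a) = r * complex.Re a.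
Proof. by case: a => [? ?] /=; rewrite mul0r subr0. Qed.

Lemma diskE (z : R[i]) : disk z <-> rnorm z < 1.
Proof. by rewrite /disk/= rnorm_lt. Qed.

End RealNorm.

Section Derivatives.
Context {R : realType}.
Implicit Types V W : normedModType R[i].

(** The parameter is real while the scalars are complex, hence the remainder
    condition in terms of [rnorm] and the embedding of R in R[i]. *)
Definition curve_deriv V (u : R -> V) (t : R) (v : V) : Prop :=
  forall e : R, 0 < e -> exists2 d : R, 0 < d &
    forall h : R, `|h| < d -> rnorm (u (t + h) - u t - h%:C *: v) <= e * `|h|.

Definition complex_deriv V (f : R[i] -> V) (z : R[i]) (v : V) : Prop :=
  forall e : R, 0 < e -> exists2 d : R, 0 < d &
    forall h : R[i], rnorm h < d ->
      rnorm (f (z + h) - f z - h *: v) <= e * rnorm h.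

Lemma complex_derivP V (f : R[i] -> V) z v :
  complex_deriv f z v <-> is_derive (z : R[i]^o) (1 : R[i]^o) (f : R[i]^o -> V) v.
Proof.
split=> [fz|[df dE] e e0].
  have cv : h^-1 *: (((f : R[i]^o -> V) \o shift (z : R[i]^o)) (h *: 1) - f z)
      @[h --> (0 : R[i]^o)^'] --> v.
    apply/cvgrPdist_le => e e0.
    have eE : (complex.Re e)%:C = e by exact: RRe_real (gtr0_real e0).
    have e0' : 0 < complex.Re e by rewrite -(ltcR 0) eE.
    have [d d0 H] := fz _ e0'.
    have d0' : 0 < d%:C by rewrite (ltcR 0).
    exists d%:C => //= h; rewrite /ball_/= sub0r normrN -rnorm_lt => hd h0.
    rewrite -eE -rnorm_le.
    have := H h hd.
    have -> : v - h^-1 *: (f (h%:A + z) - f z) =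
        - (h^-1 *: (f (z + h) - f z - h *: v)).
      rewrite [h%:A]mulr1 (addrC h) [in RHS]scalerBr scalerA mulVf// scale1r.
      by rewrite opprB.
    by rewrite rnormN rnormZ rnormV => ?; rewrite mulrC ler_pdivrMr ?rnorm_gt0.
  by apply: DeriveDef; [apply/cvg_ex; exists v|exact: cvg_lim cv].
have e0' : 0 < e%:C by rewrite (ltcR 0).
have := df; rewrite /derivable -/(derive (f : R[i]^o -> V) _ 1) dE.
move=> /cvgrPdist_le /(_ _ e0')[d /= d0 H].
have dEr : (complex.Re d)%:C = d by exact: RRe_real (gtr0_real d0).
exists (complex.Re d); first by rewrite -(ltcR 0) dEr.
move=> h hd; have [->|h0] := eqVneq h 0.
  by rewrite addr0 subrr scale0r subrr !rnorm0 mulr0.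
have hb : ball_ [eta Num.Def.normr] 0 d h.
  by rewrite /ball_/= sub0r normrN -dEr -rnorm_lt.
have := H _ hb h0; rewrite -rnorm_le.
have -> : v - h^-1 *: (f (h%:A + z) - f z) =
    - (h^-1 *: (f (z + h) - f z - h *: v)).
  rewrite [h%:A]mulr1 (addrC h) [in RHS]scalerBr scalerA mulVf// scale1r.
  by rewrite opprB.
rewrite rnormN rnormZ rnormV mulrC ler_pdivrMr// rnorm_gt0//.
Qed.

Lemma complex_deriv_uniq V (f : R[i] -> V) z v w :
  complex_deriv f z v -> complex_deriv f z w -> v = w.
Proof. by move=> /complex_derivP[_ <-] /complex_derivP[_ <-]. Qed.

Lemma complex_derivD V (f g : R[i] -> V) z v w :
  complex_deriv f z v -> complex_deriv g z w ->
  complex_deriv (fun z => f z + g z) z (v + w).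
Proof.
by move=> /complex_derivP fz /complex_derivP gz; apply/complex_derivP;
  exact: is_deriveD.
Qed.

Lemma complex_derivZ V (a : R[i]) (f : R[i] -> V) z v :
  complex_deriv f z v -> complex_deriv (fun z => a *: f z) z (a *: v).
Proof.
by move=> /complex_derivP fz; apply/complex_derivP; exact: is_deriveZ.
Qed.

Lemma complex_derivZl V (p : R[i] -> R[i]) z dp (x : V) :
  complex_deriv (p : R[i] -> R[i]^o) z dp ->
  complex_deriv (fun z => p z *: x) z (dp *: x).
Proof.
move=> pz e e0; have x1 : 0 < rnorm x + 1 by rewrite ltr_wpDl ?rnorm_ge0.
have [d d0 H] := pz (e / (rnorm x + 1)) (divr_gt0 e0 x1); exists d => // h hd.
rewrite scalerA -!scalerBl rnormZ.
have := ler_wpM2r (rnorm_ge0 x) (H h hd); move=> /le_trans; apply.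
rewrite mulrAC ler_wpM2r ?rnorm_ge0// -[leRHS]mulr1 -mulrA ler_wpM2l ?(ltW e0)//.
by rewrite mulrC ler_pdivrMr// mul1r lerDl.
Qed.

Lemma complex_derivV (a z : R[i]) : z != a ->
  complex_deriv ((fun z => (z - a)^-1) : R[i] -> R[i]^o) z (- (z - a) ^- 2).
Proof.
rewrite -subr_eq0 => za e e0; set p := z - a in za *.
have p0 : 0 < rnorm p by exact: rnorm_gt0.
have p20 : 0 < rnorm p / 2 by rewrite divr_gt0.
exists (Num.min (rnorm p / 2) (e * rnorm p ^+ 3 / 2)).
  by rewrite lt_min p20 divr_gt0// mulr_gt0// exprn_gt0.
move=> h; rewrite lt_min => /andP[h1 h2].
have ph : rnorm p / 2 <= rnorm (p + h).
  have := rnormB (p + h) h; rewrite addrK => ?; lra.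
have ph0 : p + h != 0.
  by apply/eqP => ph0; move: ph; rewrite ph0 rnorm0 leNgt p20.
rewrite (_ : _ - _ = h * (h / (p ^+ 2 * (p + h)))); last first.
  rewrite -[h *: _]/(h * _) (addrAC z) -/p; field.
  by rewrite za ph0.
rewrite rnormM mulrC ler_wpM2r ?rnorm_ge0// rnormM rnormV rnormM rnormX.
rewrite ler_pdivrMr; last by rewrite mulr_gt0 ?exprn_gt0// (lt_le_trans p20).
apply: (le_trans (ltW h2)); rewrite -mulrA ler_wpM2l ?(ltW e0)//.
rewrite exprSr -mulrA ler_wpM2l// exprn_ge0// ltW//.
Qed.

Lemma curve_derivD V (u u' : R -> V) t v v' :
  curve_deriv u t v -> curve_deriv u' t v' ->
  curve_deriv (fun s => u s + u' s) t (v + v').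
Proof.
move=> uv uv' e e0; have e20 : 0 < e / 2 by rewrite divr_gt0.
have [d d0 H] := uv _ e20; have [d' d'0 H'] := uv' _ e20.
exists (Num.min d d'); first by rewrite lt_min d0.
move=> h; rewrite lt_min => /andP[/H h1 /H' h2].
rewrite scalerDr (_ : _ - _ = (u (t + h) - u t - h%:C *: v) +
  (u' (t + h) - u' t - h%:C *: v')).
  by apply: (le_trans (rnormD _ _)); lra.
by rewrite [in RHS]addrACA opprD (addrACA (u _)) opprD.
Qed.

Lemma curve_deriv_bounded_linear V W (T : {linear V -> W}) (M : R) u t v :
  (forall x, rnorm (T x) <= M * rnorm x) ->
  curve_deriv u t v -> curve_deriv (T \o u) t (T v).
Proof.
move=> TM uv e e0.
have M1 : 0 < `|M| + 1 by rewrite ltr_wpDl.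
have [d d0 H] := uv _ (divr_gt0 e0 M1); exists d => // h /H h1.
rewrite /= -linearZ -!linearB; apply: (le_trans (TM _)).
have := ler_wpM2l (ltW M1) h1; rewrite mulrA mulrCA divff ?mulr1 ?gt_eqF//.
apply: le_trans; rewrite ler_wpM2r ?rnorm_ge0//.
by rewrite (le_trans (ler_norm _))// lerDl.
Qed.

Lemma curve_deriv_comp V (f : R[i] -> V) (g : R -> R[i]^o) t v dg :
  complex_deriv f (g t) v -> curve_deriv g t dg ->
  curve_deriv (f \o g) t (dg *: v).
Proof.
move=> fv gd e e0.
set A := rnorm dg + 1; set B := rnorm v + 1.
have A0 : 0 < A by rewrite ltr_wpDl ?rnorm_ge0.
have B0 : 0 < B by rewrite ltr_wpDl ?rnorm_ge0.
have e20 : 0 < e / 2 by rewrite divr_gt0.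
have [d1 d10 H1] := fv _ (divr_gt0 e20 A0).
have [d2 d20 H2] := gd _ ltr01.
have [d3 d30 H3] := gd _ (divr_gt0 e20 B0).
exists (Num.min (d1 / A) (Num.min d2 d3)).
  by rewrite !lt_min d20 d30 divr_gt0.
move=> h; rewrite !lt_min => /and3P[]; rewrite ltr_pdivlMr// => h1 /H2 h2 /H3 h3.
have [k kE] : exists k, k = g (t + h) - g t by eexists.
rewrite -kE in h2 h3.
have kA : rnorm k <= A * `|h|.
  have := @rnormD R R[i] (k - h%:C * dg) (h%:C * dg).
  rewrite subrK rnormM rnorm_real => /le_trans; apply.
  by rewrite /A mulrDl addrC mulrC lerD.
have kd1 : rnorm k < d1 by rewrite (le_lt_trans kA)// mulrC.
have gk : g (t + h) = g t + k by rewrite kE [RHS]addrC subrK.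
rewrite /= gk (_ : _ - _ = (f (g t + k) - f (g t) - k *: v) +
    (k - h%:C *: dg) *: v); last first.
  by rewrite scalerBl [RHS]addrA subrK scalerA.
apply: (le_trans (rnormD _ _)); rewrite (splitr e) mulrDl lerD//.
  apply: (le_trans (H1 _ kd1)).
  have := ler_wpM2l (ltW (divr_gt0 e20 A0)) kA.
  by rewrite mulrA divfK ?gt_eqF.
rewrite rnormZ; have := ler_wpM2r (rnorm_ge0 v) h3 => /le_trans; apply.
rewrite -!mulrA ler_wpM2l ?(ltW e0)// ler_wpM2l ?invr_ge0//.
rewrite mulrCA -[leRHS]mulr1 ler_wpM2l// mulrC ler_pdivrMr// mul1r lerDl//.
Qed.

Lemma curve_deriv_continuous V (u : R -> V) t v :
  curve_deriv u t v -> {for t, continuous u}.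
Proof.
move=> uv; apply/cvgrPdist_le => e e0.
have eE : (complex.Re e)%:C = e by exact: RRe_real (gtr0_real e0).
have e0' : 0 < complex.Re e by rewrite -(ltcR 0) eE.
have [d d0 H] := uv _ ltr01.
have B0 : 0 < rnorm v + 1 by rewrite ltr_wpDl ?rnorm_ge0.
apply/nbhs_ballP; exists (Num.min d (complex.Re e / (rnorm v + 1))).
  by rewrite /= lt_min d0 divr_gt0.
move=> s; rewrite /ball/= distrC lt_min => /andP[/H].
rewrite (addrC t) subrK mul1r ltr_pdivlMr// => h1 h2.
rewrite distrC -eE -rnorm_le; apply: le_trans (ltW h2).
have := rnormD (u s - u t - (s - t)%:C *: v) ((s - t)%:C *: v).
rewrite subrK rnormZ rnorm_real => /le_trans; apply.
by rewrite mulrDr mulr1 addrC lerD2l.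
Qed.

Lemma continuous_Re : continuous (fun z : R[i]^o => complex.Re z : R).
Proof.
move=> z; apply/(cvgrPdist_le (F := nbhs (z : R[i]^o))) => e e0.
have e0' : 0 < e%:C by rewrite (ltcR 0).
apply/nbhs_ballP; exists e%:C => // w; rewrite /ball/= -rnorm_lt => /ltW.
by apply: le_trans; rewrite -ReN -ReD ler_Re_rnorm.
Qed.

Lemma is_derive_Re (u : R -> R[i]^o) t v : curve_deriv u t v ->
  is_derive t (1 : R) (fun s => complex.Re (u s)) (complex.Re v).
Proof.
move=> uv.
have cv : h^-1 *: (((fun s => complex.Re (u s)) \o shift t) (h *: (1 : R)) -
    complex.Re (u t)) @[h --> 0^'] --> complex.Re v.
  apply/cvgrPdist_le => e e0; have [d d0 H] := uv _ e0.
  exists d => //= h; rewrite /ball_/= sub0r normrN => hd h0.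
  have h0' : 0 < `|h| by rewrite normr_gt0.
  rewrite -(ler_pM2r h0') -normrM [h%:A]mulr1 (addrC h).
  apply: le_trans (H h hd); apply: le_trans (ler_Re_rnorm _).
  rewrite !ReD !ReN ReZ -normrN le_eqVlt; apply/orP; left; apply/eqP.
  congr `| _ |; rewrite /GRing.scale/=; field; exact: h0.
by apply: DeriveDef; [apply/cvg_ex; exists (complex.Re v)|exact: cvg_lim cv].
Qed.

End Derivatives.

(** * Norming functionals, mean value inequality, circles *)

Section Functionals.
Context {R : realType}.
Implicit Types E V : normedModType R[i].

Definition contraction E (phi : {scalar E}) : Prop :=
  forall y, `|phi y| <= `|y|.

(** This is the part of the Hahn-Banach theorem that the proof uses. *)
Definition norming E : Prop :=
  forall x : E, exists phi : {scalar E}, support_functional x phi.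

Lemma smooth_norming E : smooth_space E -> norming E.
Proof.
move=> smE x; have [->|x0] := eqVneq x 0.
  exists (\0 : {scalar E}); split=> [y|]; rewrite /= ?normr0//.
have nx0 : `|x| != 0 by rewrite normr_eq0.
have [|phi [[phi1 phix] _]] := smE (`|x|^-1 *: x).
  by rewrite normrZ normfV normr_id mulVf.
exists phi; split=> //; move: phix.
rewrite linearZ normrZ normfV normr_id mulVf// => /(congr1 ( *%R `|x|)).
by rewrite mulVKf// mulr1.
Qed.

Lemma contraction_rnorm E (phi : {scalar E}) : contraction phi ->
  forall y, rnorm (phi y) <= 1 * rnorm y.
Proof. by move=> phi1 y; rewrite mul1r rnorm_le rnormE. Qed.

Lemma contraction_Re E (phi : {scalar E}) : contraction phi ->
  forall y, complex.Re (phi y) <= rnorm y.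
Proof.
move=> phi1 y; apply: (le_trans (ler_norm _)); apply: (le_trans (ler_Re_rnorm _)).
by rewrite -[leRHS]mul1r contraction_rnorm.
Qed.

Lemma norming_rnorm_le E (v : E) (c : R) : norming E ->
  (forall phi : {scalar E}, contraction phi -> complex.Re (phi v) <= c) ->
  rnorm v <= c.
Proof.
by move=> nE H; have [phi [phi1 phiv]] := nE v; rewrite /rnorm -phiv; exact: H.
Qed.

Lemma curve_derivZ V (c : R[i]) (u : R -> V) t v :
  curve_deriv u t v -> curve_deriv (fun s => c *: u s) t (c *: v).
Proof.
apply: (@curve_deriv_bounded_linear R V V ( *:%R c) (rnorm c)) => x.
by rewrite rnormZ.
Qed.

Lemma curve_deriv_affine V (a b : V) t :
  curve_deriv (fun s : R => a + s%:C *: b) t b.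
Proof.
move=> e e0; exists 1 => // h _ /=; rewrite (_ : _ - _ = 0) ?rnorm0.
  by rewrite mulr_ge0// ltW.
by rewrite rmorphD/= scalerDl opprD addrACA subrr add0r addrAC addrK subrr.
Qed.

Lemma curve_derivV (g : R -> R[i]^o) t dg a : g t != a ->
  curve_deriv g t dg ->
  curve_deriv (fun s => (g s - a)^-1 : R[i]^o) t (- (dg / (g t - a) ^+ 2)).
Proof.
move=> ga gd; have := curve_deriv_comp (complex_derivV ga) gd.
by rewrite /comp -[_ *: _]/(dg * _) mulrN.
Qed.

Lemma is_derive_ReM (c : R[i]) (u : R -> R[i]^o) t v : curve_deriv u t v ->
  is_derive t (1 : R) (fun s => complex.Re (c * u s)) (complex.Re (c * v)).
Proof. by move=> /(curve_derivZ c)/is_derive_Re. Qed.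

Lemma continuousCM (u v : R -> R[i]^o) : continuous u -> continuous v ->
  continuous (fun s => u s * v s : R[i]^o).
Proof. by move=> cu cv s; apply: (@cvgM R[i]); [exact: cu|exact: cv]. Qed.

Lemma continuous_ReM (c : R[i]) (u : R -> R[i]^o) : continuous u ->
  continuous (fun s => complex.Re (c * u s)).
Proof.
move=> cu s; apply: (@continuous_comp R R[i]^o R (fun s => c * u s)
  (fun z => complex.Re z) s); last exact: continuous_Re.
by apply: (@continuousCM (fun=> c) u) => //; exact: cst_continuous.
Qed.

Lemma curve_mean_value E (u du : R -> E) (a b c : R) : norming E -> a <= b ->
  (forall s, a <= s <= b -> curve_deriv u s (du s)) ->
  (forall s, a <= s <= b -> rnorm (du s) <= c) ->
  rnorm (u b - u a) <= c * (b - a).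
Proof.
move=> nE ab ud duc; apply: norming_rnorm_le => // phi phi1.
have pd s : a <= s <= b ->
    is_derive s (1 : R) (fun s => complex.Re (phi (u s))) (complex.Re (phi (du s))).
  move=> /ud us; apply: is_derive_Re.
  exact: (@curve_deriv_bounded_linear R E R[i]^o phi 1 _ _ _ (contraction_rnorm phi1) us).
have [| |s] := @MVT_segment R (fun s => complex.Re (phi (u s)))
    (fun s => complex.Re (phi (du s))) a b ab.
- by move=> s; rewrite in_itv/= => /andP[a1 b1]; apply: pd; rewrite !ltW.
- apply: derivable_within_continuous => s; rewrite in_itv/= => sab.
  by have [] := pd s sab.
rewrite in_itv/= => sab; rewrite linearB ReD ReN => ->.
rewrite ler_wpM2r ?subr_ge0//; apply: le_trans (duc s sab).
exact: contraction_Re.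
Qed.

End Functionals.

Section Circle.
Context {R : realType}.

Definition circ (r t : R) : R[i] := (r * cos t) +i* (r * sin t).

Lemma rnorm_circ (r t : R) : 0 <= r -> rnorm (circ r t) = r.
Proof.
move=> r0; apply/eqP; rewrite -(@eqrXn2 _ 2) ?rnorm_ge0// rnorm_sqr/=.
by rewrite !exprMn -mulrDr cos2Dsin2 mulr1.
Qed.

Lemma circ_periodic (r t : R) : circ r (t + 2 * pi) = circ r t.
Proof. by rewrite /circ mulr_natl cosD2pi sinD2pi. Qed.

Lemma curve_deriv_complex (x y : R -> R) t dx dy :
  is_derive t (1 : R) x dx -> is_derive t (1 : R) y dy ->
  curve_deriv (fun s => x s +i* y s : R[i]^o) t (dx +i* dy).
Proof.
have H (x' : R -> R) dx' : is_derive t (1 : R) x' dx' -> forall e, 0 < e ->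
    exists2 d, 0 < d & forall h : R, `|h| < d ->
      `|x' (t + h) - x' t - h * dx'| <= e * `|h|.
  move=> [dfx xE] e e0; move: dfx; rewrite /derivable -/(derive x' _ 1) xE.
  move=> /cvgrPdist_le /(_ _ e0)[d /= d0 Hd]; exists d => // h hd.
  have [->|h0] := eqVneq h 0; first by rewrite addr0 subrr mul0r subrr normr0 mulr0.
  have h0' : 0 < `|h| by rewrite normr_gt0.
  have := Hd h; rewrite /ball_/= sub0r normrN => /(_ hd h0).
  rewrite -(ler_pM2r h0') -normrM [h%:A]mulr1 (addrC h) => /(le_trans _); apply.
  rewrite -normrN le_eqVlt; apply/orP; left; apply/eqP.
  congr `| _ |; rewrite /GRing.scale/=; field; exact: h0.
move=> /H Hx /H Hy e e0; have e20 : 0 < e / 2 by rewrite divr_gt0.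
have [d1 d10 H1] := Hx _ e20; have [d2 d20 H2] := Hy _ e20.
exists (Num.min d1 d2); first by rewrite lt_min d10.
move=> h; rewrite lt_min => /andP[/H1 h1 /H2 h2].
set X := x (t + h) - _ - _ in h1; set Y := y (t + h) - _ - _ in h2.
rewrite (_ : _ - _ = X%:C + 'i * Y%:C :> R[i]); last first.
  by apply/eqP; rewrite eq_complex/=; apply/andP; split; apply/eqP; rewrite /X /Y; ring.
apply: (le_trans (rnormD _ _)); rewrite rnormM rnorm_i mul1r !rnorm_real; lra.
Qed.

Lemma curve_deriv_circ (r t : R) :
  curve_deriv (circ r : R -> R[i]^o) t ('i * circ r t).
Proof.
have -> : 'i * circ r t = (r * - sin t) +i* (r * cos t) :> R[i].
  by apply/eqP; rewrite eq_complex/=; apply/andP; split; apply/eqP; ring.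
by apply: curve_deriv_complex; apply: (@is_deriveZ R R R _ r).
Qed.

Lemma continuous_circ (r : R) : continuous (circ r : R -> R[i]^o).
Proof. by move=> t; exact: curve_deriv_continuous (curve_deriv_circ r t). Qed.

Lemma circ_neq (r t : R) w : rnorm w < r -> circ r t != w.
Proof.
move=> wr; have r0 : 0 <= r by rewrite (le_trans (rnorm_ge0 w)) ?ltW.
by apply/eqP => cw; move: wr; rewrite -cw rnorm_circ ?ltxx.
Qed.

Lemma circ_dist (r t : R) w : rnorm w < r -> r - rnorm w <= rnorm (circ r t - w).
Proof.
move=> wr; have r0 : 0 <= r by rewrite (le_trans (rnorm_ge0 w)) ?ltW.
have := rnormD (circ r t - w) w; rewrite subrK rnorm_circ// => ?; lra.
Qed.

End Circle.

(** * The Cauchy kernel *)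

Section Cauchy.
Context {R : realType}.
Implicit Types E V : normedModType R[i].

(** Local boundedness of f' is the domination that allows Cauchy's formula to be
    proved by differentiating under the integral sign; it makes continuity of
    f' a consequence. *)
Definition holomorphic V (f f' : R[i] -> V) : Prop :=
  (forall z, rnorm z < 1 -> complex_deriv f z (f' z)) /\
  (forall r : R, r < 1 ->
     exists M : R, forall z, rnorm z <= r -> rnorm (f' z) <= M).

Lemma eq_endpoints (H : R -> R) :
  (forall s : R, 0 <= s <= 1 -> derivable H s 1) ->
  (forall s : R, 0 < s < 1 -> is_derive s (1 : R) H 0) -> H 1 = H 0.
Proof.
move=> dH H0.
have H0' (s : R) : s \in `]0, 1[ -> is_derive s (1 : R) H (cst 0 s).
  by rewrite in_itv/=; exact: H0.
have cH : {within `[0, 1], continuous H}.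
  by apply: derivable_within_continuous => s; rewrite in_itv/=; exact: dH.
have [s _] := @MVT_segment R H (cst 0) 0 1 ler01 H0' cH.
by rewrite mul0r => /eqP; rewrite subr_eq0 => /eqP.
Qed.

Lemma curve_deriv_invB (p q : R[i]) s : p - s%:C * q != 0 ->
  curve_deriv (fun s => (p - s%:C * q)^-1 : R[i]^o) s (q / (p - s%:C * q) ^+ 2).
Proof.
move=> pq0; have gd := curve_deriv_affine (p : R[i]^o) (- q) s.
have gE s' : p + s'%:C *: (- q : R[i]^o) = p - s'%:C * q by rewrite scalerN.
have := @curve_derivV R (fun s => p + s%:C *: (- q : R[i]^o)) s (- q) 0.
rewrite gE => /(_ pq0 gd).
rewrite subr0 mulNr opprK; congr curve_deriv.
by apply/funext => s'; rewrite gE subr0.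
Qed.

Lemma curve_deriv_shift V (b : V) (u : R -> V) t v :
  curve_deriv u t v -> curve_deriv (fun s => b + u s) t v.
Proof.
move=> uv e e0; have [d d0 H] := uv _ e0; exists d => // h /H.
by rewrite opprD addrACA subrr add0r.
Qed.

Lemma ler_Re_bound (z : R[i]) (M : R) : rnorm z <= M -> `|complex.Re z| <= M.
Proof. exact: le_trans (ler_Re_rnorm z). Qed.

Lemma circ_ge (r t : R) w : rnorm w < r -> forall m, rnorm w <= m -> m < r ->
  r - m <= rnorm (circ r t - w).
Proof. by move=> wr m wm mr; have := circ_dist t wr; lra. Qed.

Lemma continuous_circ_sub_inv (r : R) w : rnorm w < r ->
  continuous (fun t => (circ r t - w)^-1 : R[i]^o).
Proof.
move=> wr t; apply: curve_deriv_continuous.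
exact: curve_derivV (circ_neq t wr) (curve_deriv_circ r t).
Qed.

(** The homotopy s |-> circ / (circ - s w) has value 1 at s = 0, and its
    s-derivative circ w / (circ - s w)^2 is the derivative in t of a periodic
    function, so its integral is 0. *)
Lemma cauchy_kernel_mass (r : R) (w a : R[i]) : rnorm w < r ->
  circle_int (fun t => complex.Re (a * (circ r t * (circ r t - w)^-1))) =
  complex.Re a * (2 * pi).
Proof.
move=> wr; set n := rnorm w in wr *; have n0 : 0 <= n by exact: rnorm_ge0.
have r0 : 0 < r by rewrite (le_lt_trans n0).
pose m := (n + r) / 2; pose e := (r - n) / (2 * (n + 1)).
have n10 : 0 < 2 * (n + 1) by rewrite mulr_gt0// ltr_wpDl.
have e0 : 0 < e by rewrite divr_gt0// subr_gt0.
have mr : m < r by rewrite /m; lra.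
have en : e * n <= (r - n) / 2.
  rewrite /e mulrAC ler_pdivrMr// [leRHS](_ : _ = (r - n) * (n + 1)); last by field.
  by rewrite ler_wpM2l// ?lerDl// subr_ge0 ltW.
have sw (s t : R) : 0 <= s <= 1 -> `|t - s| < e -> rnorm (t%:C * w) <= m.
  move=> /andP[s0 s1] ts; rewrite rnormM rnorm_real -/n.
  have : `|t| * n <= (1 + e) * n.
    rewrite ler_wpM2r//; have := ler_normD (t - s) s; rewrite subrK (ger0_norm s0).
    lra.
  rewrite /m; lra.
have swr (s t : R) : 0 <= s <= 1 -> `|t - s| < e -> rnorm (t%:C * w) < r.
  by move=> s01 ts; rewrite (le_lt_trans (sw s t s01 ts)).
pose f s t := complex.Re (a * (circ r t * (circ r t - s%:C * w)^-1)).
pose df s t := complex.Re (a * (circ r t * (w / (circ r t - s%:C * w) ^+ 2))).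
pose M := rnorm a * (r * (n / (r - m) ^+ 2)).
have dfM (s t x : R) : 0 <= s <= 1 -> `|t - s| < e -> `|df t x| <= M.
  move=> s01 ts; apply: ler_Re_bound; rewrite !rnormM rnormV rnormX rnorm_circ ?(ltW r0)//.
  rewrite ler_wpM2l ?rnorm_ge0// ler_wpM2l ?(ltW r0)// ler_wpM2l//.
  have h0 : 0 < (r - m) ^+ 2 by rewrite exprn_gt0// subr_gt0.
  have h1 : (r - m) ^+ 2 <= rnorm (circ r x - t%:C * w) ^+ 2.
    rewrite lerXn2r ?nnegrE ?rnorm_ge0 ?subr_ge0 ?(ltW mr)//.
    exact: circ_ge (swr s t s01 ts) _ (sw s t s01 ts) mr.
  by rewrite lef_pV2// posrE// (lt_le_trans h0).
have cf (s t : R) : 0 <= s <= 1 -> `|t - s| < e -> continuous (f t).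
  move=> s01 ts; apply: continuous_ReM; apply: continuousCM.
    exact: continuous_circ.
  exact: continuous_circ_sub_inv (swr s t s01 ts).
have dfP (s t x : R) : 0 <= s <= 1 -> `|t - s| < e -> is_derive t (1 : R) (f ^~ x) (df t x).
  move=> s01 ts; rewrite /f /df; under eq_fun do rewrite mulrA.
  rewrite (mulrA a); apply: is_derive_ReM; apply: curve_deriv_invB.
  by rewrite subr_eq0; exact: circ_neq (swr s t s01 ts).
have dI (s : R) : 0 <= s <= 1 -> is_derive s (1 : R) (fun s => circle_int (f s))
    (circle_int (df s)).
  by move=> s01; apply: (circle_int_diff e0 (cf s ^~ s01) (fun t x => dfP s t x s01)
    (fun t x => dfM s t x s01)).
have I0 (s : R) : 0 <= s <= 1 -> circle_int (df s) = 0.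
  move=> s01; have ss : `|s - s| < e by rewrite subrr normr0.
  apply: (@circle_int_periodic_derive R
    (fun t => complex.Re (a * 'i * w * (circ r t - s%:C * w)^-1)) _ M).
  - move=> x; have := curve_derivV (circ_neq x (swr s s s01 ss)) (curve_deriv_circ r x).
    move=> /(is_derive_ReM (a * 'i * w)) /is_derive_eq; apply.
    congr complex.Re; rewrite mulrN.
    have I2 : ('i : R[i]) ^+ 2 = -1 by exact: sqr_i.
    move: ((circ r x - _) ^- 2) ('i : R[i]) I2 => q I I2.
    by rewrite -[RHS]mul1r -[1]opprK -I2; ring.
  - by move=> x; exact: (dfM s).
  - by move=> x; rewrite circ_periodic.
transitivity (circle_int (f 1)).
  by rewrite /f rmorph1 mul1r.
have -> : circle_int (f 1) = circle_int (f 0).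
  apply: (@eq_endpoints (fun s => circle_int (f s))) => s; first by move=> /dI[].
  move=> /andP[s0 s1]; have s01 : 0 <= s <= 1 by rewrite !ltW.
  by rewrite -(I0 s s01); exact: dI.
rewrite -circle_int_cst; congr circle_int; apply/funext => t.
rewrite /f rmorph0 mul0r subr0 divff ?mulr1//; apply: circ_neq.
by rewrite rnorm0.
Qed.

End Cauchy.

(** * Cauchy's formula for a function and its derivative *)

Lemma holomorphic_bounded {R : realType} (E : normedModType R[i])
    (f f' : R[i] -> E) : norming E -> holomorphic f f' ->
  forall r : R, r < 1 -> exists S : R, forall z, rnorm z <= r -> rnorm (f z) <= S.
Proof.
move=> nE hf r r1; have [M HM] := hf.2 r r1.
exists (rnorm (f 0) + `|M|) => z zr.
have z0 := rnorm_ge0 z.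
have sz s : 0 <= s <= 1 -> rnorm (s%:C * z) <= rnorm z.
  by move=> /andP[s0 s1]; rewrite rnormM rnorm_real ger0_norm// ler_piMl.
have := @curve_mean_value R E (fun s => f (0 + s%:C * z))
  (fun s => z *: f' (0 + s%:C * z)) 0 1 `|M| nE ler01.
rewrite rmorph0 rmorph1 mul0r mul1r !add0r subr0 mulr1 => H.
have := rnormD (f z - f 0) (f 0); rewrite subrK => /le_trans; apply.
rewrite addrC lerD2l; apply: H => s s01.
- have fz : complex_deriv f (0 + s%:C *: (z : R[i]^o)) (f' (0 + s%:C * z)).
    by apply: hf.1; rewrite add0r (le_lt_trans (sz s s01))// (le_lt_trans zr).
  exact: curve_deriv_comp fz (@curve_deriv_affine R R[i]^o 0 z s).
- rewrite add0r rnormZ; have := HM _ (le_trans (sz s s01) zr) => h.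
  have z1 : rnorm z <= 1 by rewrite (le_trans zr)// ltW.
  rewrite (le_trans (ler_piMl (rnorm_ge0 _) z1))// (le_trans h)// ler_norm//.
Qed.

Section CauchyFormula.
Context {R : realType} (E : normedModType R[i]).
Variables (f f' : R[i] -> E) (phi : {scalar E}) (r : R) (c : R[i]).
Hypotheses (hf : holomorphic f f') (phi1 : contraction phi) (r1 : r < 1).

Let phiZ a y : phi (a *: y) = a * phi y.
Proof. by rewrite linearZ. Qed.

Let phi_curve (u : R -> E) t v (uv : curve_deriv u t v) :
  curve_deriv (fun s => phi (u s) : R[i]^o) t (phi v).
Proof.
exact: (@curve_deriv_bounded_linear R E R[i]^o phi 1 _ _ _
  (contraction_rnorm phi1) uv).
Qed.

Lemma continuous_functional_circ : 0 <= r ->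
  continuous (fun x => phi (f (circ r x)) : R[i]^o).
Proof.
move=> r0 x; apply: curve_deriv_continuous; apply: phi_curve.
by apply: curve_deriv_comp (curve_deriv_circ r x); apply: hf.1; rewrite rnorm_circ.
Qed.

(** The circle is contracted to w along p s t = w + s (circ r t - w).  The
    s-derivative of f (p s t) circ / (circ - w) is f' (p s t) circ, which for
    s > 0 is up to a constant the t-derivative of the periodic function
    f (p s t).  At s = 0 only the mass of the kernel is left. *)
Lemma cauchy_formula w : rnorm w < r ->
  circle_int (fun t => complex.Re (c * (circ r t * (circ r t - w)^-1) *
    phi (f (circ r t)))) = complex.Re (phi (f w) * c) * (2 * pi).
Proof.
move=> wr; set n := rnorm w in wr *; have n0 : 0 <= n by exact: rnorm_ge0.
have r0 : 0 < r by rewrite (le_lt_trans n0).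
(* For s within e of [0, 1] the contracted circles stay in the disk of radius
   (1 + 2 e) r = (2 - r) r = 1 - (1 - r)^2. *)
pose e := (1 - r) / 2; have e0 : 0 < e by rewrite divr_gt0// subr_gt0.
pose rho := (2 - r) * r.
have rho1 : rho < 1.
  rewrite -subr_gt0 (_ : _ - _ = (1 - r) ^+ 2); last by rewrite /rho; ring.
  by rewrite exprn_gt0// subr_gt0.
have [M HM] := hf.2 rho rho1.
pose p t x := w + t%:C * (circ r x - w).
have pin (s t x : R) : 0 <= s <= 1 -> `|t - s| < e -> rnorm (p t x) <= rho.
  move=> /andP[s0 s1] ts.
  have -> : p t x = (1 - t)%:C * w + t%:C * circ r x.
    by rewrite /p rmorphB rmorph1; ring.
  apply: (le_trans (rnormD _ _)); rewrite !rnormM !rnorm_real -/n rnorm_circ ?(ltW r0)//.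
  have : `|1 - t| * n <= `|1 - t| * r by rewrite ler_wpM2l// ltW.
  have : (`|1 - t| + `|t|) * r <= (1 + 2 * e) * r.
    rewrite ler_wpM2r ?(ltW r0)//; move: ts; rewrite ltr_norml => /andP[ts1 ts2].
    have [?|?] := ler0P t; have [?|?] := ler0P (1 - t); lra.
  rewrite /rho (_ : 1 + 2 * e = 2 - r); last by rewrite /e; field.
  rewrite mulrDl; lra.
have pin1 (s t x : R) : 0 <= s <= 1 -> `|t - s| < e -> rnorm (p t x) < 1.
  by move=> s01 ts; rewrite (le_lt_trans (pin s t x s01 ts)).
pose k x := c * (circ r x * (circ r x - w)^-1).
have kw x : circ r x - w != 0 by rewrite subr_eq0 circ_neq.
pose g t x := complex.Re (k x * phi (f (p t x))).
pose dg t x := complex.Re (c * circ r x * phi (f' (p t x))).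
have dgM (s t x : R) : 0 <= s <= 1 -> `|t - s| < e ->
    `|dg t x| <= rnorm c * r * M.
  move=> s01 ts; apply: ler_Re_bound; rewrite !rnormM rnorm_circ ?(ltW r0)//.
  rewrite ler_wpM2l ?mulr_ge0 ?rnorm_ge0 ?(ltW r0)//.
  apply: le_trans (HM _ (pin s t x s01 ts)).
  by rewrite -[leRHS]mul1r; exact: contraction_rnorm.
have circ_p t x : curve_deriv (fun x => p t x : R[i]^o) x (t%:C * ('i * circ r x)).
  have := curve_deriv_shift (w - t%:C * w : R[i]^o)
    (curve_derivZ t%:C (curve_deriv_circ r x)).
  congr curve_deriv; apply/funext => y.
  by rewrite /p -[_ *: _]/(t%:C * _); ring.
have cg (s t : R) : 0 <= s <= 1 -> `|t - s| < e -> continuous (g t).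
  move=> s01 ts x.
  apply: (@continuous_comp R R[i]^o R (fun x => k x * phi (f (p t x)))
    (fun z => complex.Re z) x); last exact: continuous_Re.
  apply: continuousCM => {}x.
    apply: (@continuousCM R (fun=> c)); first exact: cst_continuous.
    apply: continuousCM; first exact: continuous_circ.
    exact: continuous_circ_sub_inv wr.
  apply: curve_deriv_continuous; apply: phi_curve.
  exact: curve_deriv_comp (hf.1 _ (pin1 s t x s01 ts)) (circ_p t x).
have dgP (s t x : R) : 0 <= s <= 1 -> `|t - s| < e ->
    is_derive t (1 : R) (g ^~ x) (dg t x).
  move=> s01 ts.
  have pd : curve_deriv (fun t => p t x : R[i]^o) t (circ r x - w).
    exact: curve_deriv_affine.
  have := @curve_deriv_comp R E f (fun t => p t x) _ _ _ (hf.1 _ (pin1 s t x s01 ts)) pd.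
  move=> /phi_curve /(is_derive_ReM (k x)) /is_derive_eq; apply.
  congr complex.Re; rewrite phiZ /k.
  by move: (kw x) (phi _) => k0 y; field.
have dI (s : R) : 0 <= s <= 1 ->
    is_derive s (1 : R) (fun s => circle_int (g s)) (circle_int (dg s)).
  by move=> s01; apply: (circle_int_diff e0 (cg s ^~ s01) (fun t x => dgP s t x s01)
    (fun t x => dgM s t x s01)).
have I0 (s : R) : 0 < s < 1 -> circle_int (dg s) = 0.
  move=> /andP[s0 s1]; have s01 : 0 <= s <= 1 by rewrite !ltW.
  have ss : `|s - s| < e by rewrite subrr normr0.
  have sC0 : s%:C != 0 :> R[i] by rewrite (fmorph_eq0 (real_complex R)) gt_eqF.
  pose a : R[i] := - ('i : R[i]) * c / s%:C.
  have ad (x : R) : is_derive x (1 : R)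
      (fun t => complex.Re (a * phi (f (p s t)))) (dg s x).
    have := curve_deriv_comp (hf.1 _ (pin1 s s x s01 ss)) (circ_p s x).
    move=> /phi_curve /(is_derive_ReM a) /is_derive_eq; apply.
    congr complex.Re; rewrite phiZ /a.
    have I2 : ('i : R[i]) ^+ 2 = -1 by exact: sqr_i.
    move: sC0 ('i : R[i]) (phi _) I2 => sC0 I y I2.
    by rewrite -[RHS]mul1r -[1]opprK -I2; field.
  apply: (circle_int_periodic_derive ad); first by move=> x; exact: (dgM s).
  by move=> x; rewrite /p circ_periodic.
have := cauchy_kernel_mass (phi (f w) * c) wr; rewrite -/n => <-.
transitivity (circle_int (g 1)).
  congr circle_int; apply/funext => x.
  by rewrite /g /p rmorph1 mul1r [w + _]addrC subrK.
have -> : circle_int (g 1) = circle_int (g 0).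
  apply: (@eq_endpoints _ (fun s => circle_int (g s))) => s; first by move=> /dI[].
  move=> s01; rewrite -(I0 s s01); apply: dI.
  by case/andP: s01 => ? ?; rewrite !ltW.
congr circle_int; apply/funext => x.
by rewrite /g /p rmorph0 mul0r addr0 /k; congr complex.Re; ring.
Qed.

(** Cauchy's formula at w + h, for real h, differentiated at h = 0. *)
Lemma cauchy_formula_derive (S : R) w :
  (forall x, rnorm (f (circ r x)) <= S) -> rnorm w < r ->
  circle_int (fun t => complex.Re (c * (circ r t / (circ r t - w) ^+ 2) *
    phi (f (circ r t)))) = complex.Re (phi (f' w) * c) * (2 * pi).
Proof.
move=> fS wr; set n := rnorm w in wr *; have n0 : 0 <= n by exact: rnorm_ge0.
have r0 : 0 < r by rewrite (le_lt_trans n0).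
pose e := (r - n) / 2; have e0 : 0 < e by rewrite divr_gt0// subr_gt0.
pose m := (r + n) / 2; have mr : m < r by rewrite /m; lra.
have wh (h : R) : `|h - 0| < e -> rnorm (w + h%:C) <= m.
  rewrite subr0 => he; apply: (le_trans (rnormD _ _)); rewrite rnorm_real -/n.
  by rewrite /m; move: he; rewrite /e; lra.
have whr (h : R) : `|h - 0| < e -> rnorm (w + h%:C) < r.
  by move=> /wh he; rewrite (le_lt_trans he).
pose g h x := complex.Re (c * circ r x * phi (f (circ r x)) *
  (circ r x - w - h%:C * 1)^-1).
pose dg h x := complex.Re (c * circ r x * phi (f (circ r x)) *
  (1 / (circ r x - w - h%:C * 1) ^+ 2)).
have gE (h x : R) : circ r x - w - h%:C * 1 = circ r x - (w + h%:C).
  by rewrite mulr1 opprD addrA.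
pose K := rnorm c * r * S * ((r - m) ^+ 2)^-1.
have dgK (h x : R) : `|h - 0| < e -> `|dg h x| <= K.
  move=> he; apply: ler_Re_bound; rewrite gE !rnormM rnormV rnormX rnorm_circ ?(ltW r0)//.
  rewrite rnorm1 mul1r; have S0 : 0 <= S by rewrite (le_trans (rnorm_ge0 _) (fS 0)).
  apply: ler_pM.
  - by rewrite !mulr_ge0 ?rnorm_ge0 ?(ltW r0).
  - by rewrite invr_ge0 exprn_ge0 ?rnorm_ge0.
  - rewrite ler_wpM2l ?mulr_ge0 ?rnorm_ge0 ?(ltW r0)//.
    by rewrite (le_trans (contraction_rnorm phi1 _))// mul1r.
  have h0 : 0 < (r - m) ^+ 2 by rewrite exprn_gt0// subr_gt0.
  have h1 : (r - m) ^+ 2 <= rnorm (circ r x - (w + h%:C)) ^+ 2.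
    rewrite lerXn2r ?nnegrE ?rnorm_ge0 ?subr_ge0 ?(ltW mr)//.
    exact: circ_ge (whr h he) _ (wh h he) mr.
  by rewrite lef_pV2// posrE// (lt_le_trans h0).
have cg (h : R) : `|h - 0| < e -> continuous (g h).
  move=> he x.
  apply: (@continuous_comp R R[i]^o R (fun x => c * circ r x *
    phi (f (circ r x)) * (circ r x - w - h%:C * 1)^-1)
    (fun z => complex.Re z) x); last exact: continuous_Re.
  apply: continuousCM; last first.
    under eq_fun do rewrite gE; exact: continuous_circ_sub_inv (whr h he).
  apply: continuousCM; last exact: continuous_functional_circ (ltW r0).
  apply: (@continuousCM R (fun=> c)); first exact: cst_continuous.
  exact: continuous_circ.
have dgP (h x : R) : `|h - 0| < e -> is_derive h (1 : R) (g ^~ x) (dg h x).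
  move=> he; apply: is_derive_ReM; apply: curve_deriv_invB.
  by rewrite gE subr_eq0 circ_neq// whr.
have dI := circle_int_diff e0 cg (fun t x => dgP t x) (fun t x => dgK t x).
have dJ : is_derive 0 (1 : R)
    (fun h => 2 * pi * complex.Re (c * phi (f (w + h%:C * 1))))
    (2 * pi * complex.Re (c * phi (f' w))).
  have ad := @curve_deriv_affine R R[i]^o w 1 0.
  have fd : complex_deriv f (w + (0 : R)%:C *: (1 : R[i]^o)) (f' w).
    by rewrite scale0r addr0; apply: hf.1; rewrite -/n (lt_trans wr).
  have := curve_deriv_comp fd ad; rewrite scale1r => /phi_curve.
  by move=> /(is_derive_ReM c) h; exact: (@is_deriveZ R R R _ (2 * pi) _ _ _ h).
transitivity (circle_int (dg 0)).
  congr circle_int; apply/funext => x; rewrite /dg rmorph0 mul0r subr0.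
  by congr complex.Re; rewrite mul1r; ring.
transitivity (2 * pi * complex.Re (c * phi (f' w))); last by rewrite mulrC (mulrC c).
have [_ <-] := dI; have [_ <-] := dJ; apply: near_eq_derive; near=> h.
have he : `|h - 0| < e.
  near: h; apply/nbhs_ballP; exists e => //= h; rewrite /ball/= distrC//.
rewrite mulr1 mulrC (mulrC c) -(cauchy_formula (whr h he)).
congr circle_int; apply/funext => x; rewrite /g gE.
by congr complex.Re; ring.
Unshelve. all: by end_near. Qed.

End CauchyFormula.

(** * Cauchy estimates *)

Section CauchyEstimates.
Context {R : realType} (E : normedModType R[i]).
Hypothesis nE : norming E.
Variables (f f' : R[i] -> E) (r S : R).
Hypotheses (hf : holomorphic f f') (r0 : 0 <= r) (r1 : r < 1).
Hypothesis fS : forall z, rnorm z = r -> rnorm (f z) <= S.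

Let continuous_kernel (phi : {scalar E}) (k : R -> R[i]^o) :
  contraction phi -> continuous k ->
  continuous (fun x => complex.Re (k x * phi (f (circ r x)))).
Proof.
move=> phi1 ck x.
apply: (@continuous_comp R R[i]^o R (fun x => k x * phi (f (circ r x)))
  (fun z => complex.Re z) x); last exact: continuous_Re.
apply: continuousCM; first exact: ck.
exact: continuous_functional_circ hf phi1 r1 r0.
Qed.

Let fSc x : rnorm (f (circ r x)) <= S.
Proof. by apply: fS; rewrite rnorm_circ. Qed.

Let functional_bound (phi : {scalar E}) (k : R[i]) (B : R) x : contraction phi ->
  rnorm k <= B -> complex.Re (k * phi (f (circ r x))) <= B * S.
Proof.
move=> phi1 kB; apply: (le_trans (ler_norm _)); apply: (le_trans (ler_Re_rnorm _)).
rewrite rnormM ler_pM ?rnorm_ge0//.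
by apply: le_trans (contraction_rnorm phi1 _) _; rewrite mul1r.
Qed.

Lemma cauchy_estimate w : rnorm w < r -> rnorm (f w) <= r / (r - rnorm w) * S.
Proof.
move=> wr; apply: norming_rnorm_le => // phi phi1.
rewrite -(ler_pM2r period_gt0).
have := cauchy_formula 1 hf phi1 r1 wr; rewrite mulr1 => <-.
have ck : continuous (fun t => 1 * (circ r t * (circ r t - w)^-1) : R[i]^o).
  under eq_fun do rewrite mul1r; apply: continuousCM; first exact: continuous_circ.
  exact: continuous_circ_sub_inv.
apply: circle_int_ub; first exact: continuous_kernel.
move=> x; apply: functional_bound => //.
rewrite mul1r rnormM rnormV rnorm_circ// ler_wpM2l// lef_pV2 ?posrE ?subr_gt0//.
  exact: circ_dist.
by rewrite (lt_le_trans _ (circ_dist x wr))// subr_gt0.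
Qed.

(** Three terms suffice for the difference of two difference quotients of f'
    at the same point. *)
Lemma cauchy_estimate3 (c1 c2 c3 w1 w2 w3 : R[i]) (B : R) :
  rnorm w1 < r -> rnorm w2 < r -> rnorm w3 < r ->
  (forall z, rnorm z = r -> rnorm (c1 * (z / (z - w1) ^+ 2) +
     c2 * (z / (z - w2) ^+ 2) + c3 * (z / (z - w3) ^+ 2)) <= B) ->
  rnorm (c1 *: f' w1 + c2 *: f' w2 + c3 *: f' w3) <= B * S.
Proof.
move=> w1r w2r w3r kB; apply: norming_rnorm_le => // phi phi1.
rewrite -(ler_pM2r period_gt0).
have ck c w : rnorm w < r ->
    continuous (fun t => c * (circ r t / (circ r t - w) ^+ 2) : R[i]^o).
  move=> wr; apply: (@continuousCM R (fun=> c)); first exact: cst_continuous.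
  apply: continuousCM; first exact: continuous_circ.
  under eq_fun do rewrite expr2 invfM.
  by apply: continuousCM; exact: continuous_circ_sub_inv.
have cI c w wr := @cauchy_formula_derive R E f f' phi r c hf phi1 r1 S w fSc wr.
have -> : complex.Re (phi (c1 *: f' w1 + c2 *: f' w2 + c3 *: f' w3)) =
    complex.Re (phi (f' w1) * c1) + complex.Re (phi (f' w2) * c2) +
    complex.Re (phi (f' w3) * c3).
  have phiZ a y : phi (a *: y) = a * phi y by rewrite linearZ.
  have phiD a y : phi (a + y) = phi a + phi y by rewrite linearD.
  by rewrite 2!phiD !phiZ 2!ReD ![phi _ * _]mulrC.
rewrite 2!mulrDl -!cI// -circle_intD; [|exact: continuous_kernel (ck _ _ _)..].
rewrite -circle_intD; last 2 first.
- move=> x; apply: cvgD; exact: (continuous_kernel phi1 (ck _ _ _)).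
- exact: continuous_kernel (ck _ _ _).
apply: circle_int_ub => [x|x].
  by apply: cvgD; [apply: cvgD|]; exact: (continuous_kernel phi1 (ck _ _ _)).
rewrite -!ReD -!mulrDl; apply: functional_bound => //; apply: kB.
by rewrite rnorm_circ.
Qed.

End CauchyEstimates.

Section Taylor.
Context {R : realType} (E : completeNormedModType R[i]).
Hypothesis nE : norming E.
Variables (f f' : R[i] -> E).
Hypothesis (hf : holomorphic f f').

Definition diff_quot (w h : R[i]) : E := h^-1 *: (f' (w + h) - f' w).

(** Both bounds are bounds on the combinations of Cauchy kernels that represent
    the quotients.  In the first one the factor h - k comes out of the rational
    function, which gives the Cauchy property of the quotients at 0. *)
Lemma diff_quot_lipschitz (rho : R) : 0 <= rho -> rho < 1 ->
  exists2 C : R, 0 <= C & forall w h k : R[i], rnorm w <= rho ->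
    h != 0 -> k != 0 -> rnorm (w + h) <= rho -> rnorm (w + k) <= rho ->
    rnorm (diff_quot w h - diff_quot w k) <= C * rnorm (h - k) /\
    rnorm (diff_quot w h) <= C.
Proof.
move=> rho0 rho1; pose r := (1 + rho) / 2.
have r0 : 0 <= r by rewrite divr_ge0// addr_ge0.
have r1 : r < 1 by rewrite /r; lra.
have [S0 HS] := holomorphic_bounded nE hf r1; pose S := `|S0|.
have fS z : rnorm z = r -> rnorm (f z) <= S.
  by move=> zr; apply: le_trans (ler_norm S0); apply: HS; rewrite zr.
pose d := r - rho; have d0 : 0 < d by rewrite /d /r; lra.
have dle (z w : R[i]) : rnorm z = r -> rnorm w <= rho -> d <= rnorm (z - w).
  by move=> zr wr; have := rnormD (z - w) w; rewrite subrK zr /d; lra.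
have rr (w : R[i]) : rnorm w <= rho -> rnorm w < r by rewrite /r; lra.
pose C1 := 32 * d ^- 6; pose C2 := 6 * d ^- 4.
have C10 : 0 <= C1 by rewrite mulr_ge0// invr_ge0 exprn_ge0// ltW.
have C20 : 0 <= C2 by rewrite mulr_ge0// invr_ge0 exprn_ge0// ltW.
have S0' : 0 <= S by exact: normr_ge0.
exists (C1 * S + C2 * S); first by rewrite addr_ge0// mulr_ge0.
move=> w h k wr h0 k0 whr wkr.
have n2 (a b : R[i]) : rnorm a <= 1 -> rnorm b <= 1 -> rnorm (a - b) <= 2.
  by move=> a1 b1; have := rnormB a b; lra.
have hn : rnorm h <= 2.
  by have := rnormB (w + h) w; rewrite addrAC subrr add0r; lra.
have kn : rnorm k <= 2.
  by have := rnormB (w + k) w; rewrite addrAC subrr add0r; lra.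
have inv_le (z : R[i]) (n : nat) : d <= rnorm z -> (rnorm z ^+ n)^-1 <= d ^- n.
  move=> dz; rewrite lef_pV2 ?posrE ?exprn_gt0// ?(lt_le_trans d0)//.
  by rewrite lerXn2r ?nnegrE ?rnorm_ge0// ltW.
have kernels (z : R[i]) : rnorm z = r ->
    [/\ rnorm (h^-1 * (z / (z - (w + h)) ^+ 2) + - k^-1 * (z / (z - (w + k)) ^+ 2) +
      (k^-1 - h^-1) * (z / (z - w) ^+ 2)) <= C1 * rnorm (h - k) &
      rnorm (h^-1 * (z / (z - (w + h)) ^+ 2) + - h^-1 * (z / (z - w) ^+ 2) +
      0 * (z / (z - w) ^+ 2)) <= C2].
  move=> zr; have du := dle z w zr wr; have duh := dle z _ zr whr.
  have duk := dle z _ zr wkr.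
  rewrite opprD addrA in duh; rewrite opprD addrA in duk.
  have nz (v : R[i]) : d <= rnorm v -> v != 0.
    by move=> dv; apply/eqP => v0; move: dv; rewrite v0 rnorm0 leNgt d0.
  have u2 : rnorm (z - w) <= 2 by apply: n2; rewrite ?zr; lra.
  rewrite !opprD !addrA; move: (z - w) du duh duk u2 => u du duh duk u2.
  have [u0 uh0 uk0] := And3 (nz _ du) (nz _ duh) (nz _ duk).
  have u_ge := rnorm_ge0 u; have h_ge := rnorm_ge0 h; have k_ge := rnorm_ge0 k.
  split.
    have -> : h^-1 * (z / (u - h) ^+ 2) + - k^-1 * (z / (u - k) ^+ 2) +
        (k^-1 - h^-1) * (z / u ^+ 2) =
        (z * (3 * u ^+ 2 - 2 * u * (h + k) + h * k) /
          (u ^+ 2 * (u - h) ^+ 2 * (u - k) ^+ 2)) * (h - k).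
      by field; rewrite h0 k0 u0 uh0 uk0.
    rewrite rnormM ler_wpM2r ?rnorm_ge0// rnormM rnormV 3!rnormM !rnormX zr.
    have num : rnorm (3 * u ^+ 2 - 2 * u * (h + k) + h * k) <= 32.
      apply: (le_trans (rnormD _ _)); rewrite rnormM.
      have := rnormB (3 * u ^+ 2) (2 * u * (h + k)).
      rewrite 3!rnormM rnormX !rnorm_nat => b1.
      have b2 := rnormD h k.
      have b3 : rnorm h * rnorm k <= 2 * 2 by apply: ler_pM.
      have b4 : rnorm u * rnorm (h + k) <= 2 * 4.
        by apply: ler_pM => //; [exact: rnorm_ge0|lra].
      have b5 : rnorm u ^+ 2 <= 2 * 2 by rewrite expr2; apply: ler_pM.
      lra.
    have den : (rnorm u ^+ 2 * rnorm (u - h) ^+ 2 * rnorm (u - k) ^+ 2)^-1 <= d ^- 6.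
      rewrite 2!invfM (_ : d ^- 6 = d ^- 2 * d ^- 2 * d ^- 2); last first.
        by rewrite -!invfM -!exprD.
      by rewrite !ler_pM ?mulr_ge0 ?invr_ge0 ?exprn_ge0 ?rnorm_ge0 ?inv_le.
    apply: ler_pM => //; first by rewrite mulr_ge0 ?rnorm_ge0.
      by rewrite invr_ge0 !mulr_ge0 ?exprn_ge0 ?rnorm_ge0.
    rewrite -[leRHS]mul1r ler_pM ?rnorm_ge0// ltW//.
  have -> : h^-1 * (z / (u - h) ^+ 2) + - h^-1 * (z / u ^+ 2) + 0 * (z / u ^+ 2) =
      z * (2 * u - h) / (u ^+ 2 * (u - h) ^+ 2).
    by field; rewrite h0 u0 uh0.
  rewrite rnormM rnormV 2!rnormM !rnormX zr.
  have num : rnorm (2 * u - h) <= 6.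
    by have := rnormB (2 * u) h; rewrite rnormM rnorm_nat; lra.
  have den : (rnorm u ^+ 2 * rnorm (u - h) ^+ 2)^-1 <= d ^- 4.
    rewrite invfM (_ : d ^- 4 = d ^- 2 * d ^- 2); last by rewrite -!invfM -!exprD.
    by rewrite !ler_pM ?invr_ge0 ?exprn_ge0 ?rnorm_ge0 ?inv_le.
  apply: ler_pM => //; first by rewrite mulr_ge0 ?rnorm_ge0.
    by rewrite invr_ge0 !mulr_ge0 ?exprn_ge0 ?rnorm_ge0.
  rewrite -[leRHS]mul1r ler_pM ?rnorm_ge0// ltW//.
split.
  have -> : diff_quot w h - diff_quot w k = h^-1 *: f' (w + h) +
      (- k^-1) *: f' (w + k) + (k^-1 - h^-1) *: f' w.
    rewrite /diff_quot !scalerBr scalerBl opprB scaleNr.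
    by rewrite addrACA [RHS]addrACA; congr (_ + _); rewrite addrC.
  have := cauchy_estimate3 nE hf r0 r1 fS (rr _ whr) (rr _ wkr) (rr _ wr)
    (fun z zr => (kernels z zr).1).
  move=> /le_trans; apply; rewrite mulrAC ler_wpM2r ?rnorm_ge0//.
  by rewrite lerDl mulr_ge0.
have -> : diff_quot w h = h^-1 *: f' (w + h) + (- h^-1) *: f' w + 0 *: f' w.
  by rewrite /diff_quot scale0r addr0 scaleNr scalerBr.
have := cauchy_estimate3 nE hf r0 r1 fS (rr _ whr) (rr _ wr) (rr _ wr)
  (fun z zr => (kernels z zr).2).
by move=> /le_trans; apply; rewrite lerDr mulr_ge0.
Qed.

End Taylor.

(** * The second derivative, and holomorphic functions of constant norm *)

Section SecondDerivative.
Context {R : realType} (E : completeNormedModType R[i]).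
Hypothesis nE : norming E.
Variables (f f' : R[i] -> E).
Hypothesis (hf : holomorphic f f').

Definition second_deriv (w : R[i]) : E :=
  lim (diff_quot f' w h @[h --> (0 : R[i]^o)^']).

Lemma near_dnbhs0_lt (e : R) : 0 < e -> \forall h \near (0 : R[i]^o)^', rnorm (h : R[i]) < e.
Proof.
move=> e0; have e0' : 0 < e%:C by rewrite (ltcR 0).
exists e%:C => // h /=; rewrite sub0r normrN -rnorm_lt => ? _ //.
Qed.

Lemma near_dnbhs0_neq : \forall h \near (0 : R[i]^o)^', (h : R[i]) != 0.
Proof. exact: nbhs_dnbhs_neq. Qed.

Lemma diff_quot_cvg w : rnorm w < 1 ->
  diff_quot f' w h @[h --> (0 : R[i]^o)^'] --> second_deriv w.
Proof.
move=> w1; pose rho := (1 + rnorm w) / 2.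
have rho0 : 0 <= rho by rewrite divr_ge0// addr_ge0// rnorm_ge0.
have rho1 : rho < 1 by rewrite /rho; lra.
have [C C0 HC] := diff_quot_lipschitz nE hf rho0 rho1.
apply: cauchy_cvg; apply: cauchy_exP => e e0.
have eE : (complex.Re e)%:C = e by exact: RRe_real (gtr0_real e0).
have e0' : 0 < complex.Re e by rewrite -(ltcR 0) eE.
pose d := Num.min (rho - rnorm w) (complex.Re e / (2 * (C + 1))).
have C1 : 0 < C + 1 by rewrite ltr_wpDl.
have d0 : 0 < d by rewrite lt_min subr_gt0 /rho divr_gt0 ?mulr_gt0//; lra.
near (0 : R[i]^o)^' => k; exists (diff_quot f' w k).
have hw h : rnorm h < d -> rnorm (w + h) <= rho.
  rewrite lt_min => /andP[hd _]; apply: (le_trans (rnormD _ _)); lra.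
have kd : rnorm k < d by near: k; exact: near_dnbhs0_lt.
have k0 : k != 0 by near: k; exact: near_dnbhs0_neq.
change (\forall h \near (0 : R[i]^o)^', ball (diff_quot f' w k) e (diff_quot f' w h)).
near=> h.
have hd : rnorm h < d by near: h; exact: near_dnbhs0_lt.
have h0 : h != 0 by near: h; exact: near_dnbhs0_neq.
rewrite -ball_normE/= -eE -rnorm_lt.
have wr : rnorm w <= rho by rewrite /rho; lra.
have [H _] := HC w k h wr k0 h0 (hw k kd) (hw h hd).
apply: (le_lt_trans H); have := rnormB k h => kh.
have : rnorm (k - h) < 2 * d by lra.
have : d <= complex.Re e / (2 * (C + 1)) by rewrite ge_min lexx orbT.
rewrite ler_pdivlMr ?mulr_gt0// => d1 d2.
apply: (@le_lt_trans _ _ (C * (2 * d))); first by rewrite ler_wpM2l// ltW.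
lra.
Unshelve. all: by end_near. Qed.

(** The Lipschitz bound on the quotients passes to the limit: the quotient of
    increment h is within C |h| of the second derivative. *)
Lemma second_order_estimate (rho : R) : 0 <= rho -> rho < 1 ->
  exists2 C : R, 0 <= C & forall w z : R[i], rnorm w <= rho -> rnorm z <= rho ->
    rnorm (f' z - f' w - (z - w) *: second_deriv w) <= C * rnorm (z - w) ^+ 2 /\
    rnorm (second_deriv w) <= C.
Proof.
move=> rho0 rho1; pose rho' := (1 + rho) / 2.
have rho'0 : 0 <= rho' by rewrite divr_ge0// addr_ge0.
have rho'1 : rho' < 1 by rewrite /rho'; lra.
have [C C0 HC] := diff_quot_lipschitz nE hf rho'0 rho'1.
have C1 : 0 < C + 1 by rewrite ltr_wpDl.
have approx (w : R[i]) (e : R) : rnorm w <= rho -> 0 < e -> exists k : R[i],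
    [/\ k != 0, rnorm k <= e, rnorm (w + k) <= rho' &
      rnorm (second_deriv w - diff_quot f' w k) <= e].
  move=> wr e0; have w1 : rnorm w < 1 by lra.
  have e0' : 0 < e%:C by rewrite (ltcR 0).
  have /cvgrPdist_le/(_ _ e0') cv := diff_quot_cvg w1.
  near (0 : R[i]^o)^' => k; exists (k : R[i]); split.
  - near: k; exact: near_dnbhs0_neq.
  - apply: ltW; near: k; exact: near_dnbhs0_lt.
  - have : rnorm (k : R[i]) < rho' - rho.
      by near: k; apply: near_dnbhs0_lt; rewrite /rho'; lra.
    by have := rnormD w (k : R[i]); lra.
  - by rewrite rnorm_le; near: k; exact: cv.
exists C => // w z wr zr; have wr' : rnorm w <= rho' by rewrite /rho'; lra.
split; last first.
  apply/ler_addgt0Pr => e /(approx w _ wr) [k [k0 _ wkr kw]].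
  have [_ A1] := HC w k k wr' k0 k0 wkr wkr.
  have := rnormD (second_deriv w - diff_quot f' w k) (diff_quot f' w k).
  rewrite subrK; lra.
have [->|zw] := eqVneq z w.
  by rewrite !subrr scale0r subrr !rnorm0 expr0n mulr0.
have [h hE] : exists h, h = z - w by eexists.
have h0 : h != 0 by rewrite hE subr_eq0.
have {hE} zE : z = w + h by rewrite hE addrC subrK.
rewrite {}zE in zr *; rewrite (addrAC w h) subrr add0r.
have whr' : rnorm (w + h) <= rho' by rewrite /rho'; lra.
have -> : f' (w + h) - f' w - h *: second_deriv w =
    h *: (diff_quot f' w h - second_deriv w).
  by rewrite scalerBr /diff_quot scalerA divff// scale1r.
rewrite rnormZ expr2 mulrCA ler_wpM2l ?rnorm_ge0//.
apply/ler_addgt0Pr => e e0.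
have [k [k0 ke wkr kw]] := approx w (e / (C + 1)) wr (divr_gt0 e0 C1).
have [A1 _] := HC w h k wr' h0 k0 whr' wkr.
have A4 := rnormB (diff_quot f' w h - diff_quot f' w k)
  (second_deriv w - diff_quot f' w k).
rewrite opprB addrA subrK in A4.
have A6 := ler_wpM2l C0 (rnormB h k).
have A7 := ler_wpM2l C0 ke.
have de : e / (C + 1) * (C + 1) = e by rewrite divfK ?gt_eqF.
lra.
Unshelve. all: by end_near. Qed.

Lemma holomorphic_derive : holomorphic f' second_deriv.
Proof.
split=> [w w1|rho rho1].
  pose rho := (1 + rnorm w) / 2.
  have rho0 : 0 <= rho by rewrite divr_ge0// addr_ge0// rnorm_ge0.
  have rho1 : rho < 1 by rewrite /rho; lra.
  have [C C0 HC] := second_order_estimate rho0 rho1.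
  move=> e e0; have C1 : 0 < C + 1 by rewrite ltr_wpDl.
  exists (Num.min (rho - rnorm w) (e / (C + 1))).
    by rewrite lt_min subr_gt0 divr_gt0// andbT /rho; lra.
  move=> h; rewrite lt_min ltr_pdivlMr// => /andP[h1 h2].
  have whr : rnorm (w + h) <= rho by have := rnormD w h; lra.
  have wr : rnorm w <= rho by rewrite /rho; lra.
  have [H _] := HC w (w + h) wr whr; move: H; rewrite (addrAC w h) subrr add0r.
  move=> /le_trans; apply; rewrite expr2 mulrA ler_wpM2r ?rnorm_ge0//.
  have := rnorm_ge0 h; lra.
have m0 : 0 <= Num.max rho 0 by rewrite le_max lexx orbT.
have m1 : Num.max rho 0 < 1 by rewrite gt_max rho1 ltr01.
have [C C0 HC] := second_order_estimate m0 m1; exists C => z zr.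
have zm : rnorm z <= Num.max rho 0 by rewrite le_max zr.
by have [] := HC z z zm zm.
Qed.

End SecondDerivative.

Section ConstantNorm.
Context {R : realType} (E : normedModType R[i]).

Lemma strictly_convex_functional (nE : norming E) (x y : E) (phi : {scalar E}) :
  strictly_convex_space E -> contraction phi -> rnorm x = rnorm y ->
  complex.Re (phi x) = rnorm x -> complex.Re (phi y) = rnorm x -> x = y.
Proof.
move=> scE phi1 xy phix phiy; have [x0|x0] := eqVneq x 0.
  by rewrite x0 rnorm0 in xy *; rewrite (rnorm_eq0 (esym xy)).
apply/eqP/negPn/negP => xNy; have n0 := rnorm_gt0 x0.
pose b : R[i] := (rnorm x)^-1%:C; have bE : b = `|x|^-1 by rewrite /b fmorphV /= rnormE.
have nx : `|x| != 0 by rewrite normr_eq0.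
have yx : `|y| = `|x| by rewrite -!rnormE xy.
have bn (z : E) : `|z| = `|x| -> `|b *: z| = 1.
  by move=> zx; rewrite normrZ bE normfV normr_id zx mulVf.
have b0 : b != 0 by rewrite bE invr_eq0.
have := scE _ _ (bn x erefl) (bn y yx).
rewrite -subr_eq0 -scalerBr scaler_eq0 negb_or b0 subr_eq0 => /(_ xNy).
rewrite -scalerDr scalerA -(rnorm_lt _ 1); apply/negP; rewrite -leNgt.
apply: le_trans (contraction_Re phi1 _).
have phiZ a z : phi (a *: z) = a * phi z by rewrite linearZ.
have phiD a z : phi (a + z) = phi a + phi z by rewrite linearD.
have -> : 2^-1 * b = (2^-1 * (rnorm x)^-1)%:C by rewrite rmorphM fmorphV rmorph_nat.
rewrite phiZ phiD ReZ ReD phix phiy.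
by rewrite [leRHS](_ : _ = 1)//; field; rewrite gt_eqF.
Qed.

(** Let phi norm g 0.  The mean of Re phi(g) over a circle around 0 is
    Re phi(g 0), the largest value that Re phi(g) can take; so Re phi(g) equals
    it on the whole circle, and strict convexity identifies the vectors. *)
Lemma holomorphic_cst_norm (g g' : R[i] -> E) (b : R) : norming E ->
  strictly_convex_space E -> holomorphic g g' ->
  (forall z, rnorm z < 1 -> rnorm (g z) = b) ->
  forall z, rnorm z < 1 -> g z = g 0.
Proof.
move=> nE scE hg gb z z1; have [->//|z0] := eqVneq z 0.
pose r := rnorm z; have r0 : 0 < r by exact: rnorm_gt0.
(* The rotation by a moves the point at angle pi to z, an interior point of the
   interval of integration. *)
pose a : R[i] := - z / r%:C.
have rC0 : r%:C != 0 :> R[i] by rewrite (fmorph_eq0 (real_complex R)) gt_eqF.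
have a1 : rnorm a = 1.
  by rewrite rnormM rnormV rnormN rnorm_real ger0_norm ?(ltW r0)// divff// gt_eqF.
have an w : rnorm (a * w) = rnorm w by rewrite rnormM a1 mul1r.
have hga : holomorphic (fun w => g (a * w)) (fun w => a *: g' (a * w)).
  split=> [w w1|rho rho1].
    have aw1 : rnorm (a * w) < 1 by rewrite an.
    move=> e e0; have [d d0 H] := hg.1 _ aw1 e e0; exists d => // h hd.
    by have := H (a * h); rewrite an mulrDr scalerA (mulrC h) => /(_ hd).
  have [M HM] := hg.2 rho rho1; exists M => w wr.
  by rewrite rnormZ a1 mul1r; apply: HM; rewrite an.
have b1 : rnorm (g 0) = b by apply: gb; rewrite rnorm0.
have [phi [phi1 phig]] := nE (g 0).
pose u t := b - complex.Re (phi (g (a * circ r t))).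
have cphi : continuous (fun t => complex.Re (phi (g (a * circ r t)))).
  move=> t; apply: (@continuous_comp R R[i]^o R (fun t => phi (g (a * circ r t)))
    (fun z => complex.Re z) t); last exact: continuous_Re.
  exact: (continuous_functional_circ hga phi1 z1 (ltW r0)).
have cu : continuous u.
  by move=> t; apply: cvgB; [exact: cvg_cst|exact: cphi].
have u0 t : 0 <= u t.
  rewrite subr_ge0 -(gb (a * circ r t)) ?contraction_Re//.
  by rewrite an rnorm_circ ?(ltW r0).
have Iu : circle_int u = 0.
  have w0r : rnorm (0 : R[i]) < r by rewrite rnorm0.
  have := cauchy_formula 1 hga phi1 z1 w0r; rewrite mulr0 mulr1 phig -/(rnorm _) b1.
  have -> : (fun t => complex.Re (1 * (circ r t / (circ r t - 0)) *
      phi (g (a * circ r t)))) = (fun t => complex.Re (phi (g (a * circ r t)))).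
    apply/funext => t; rewrite subr0 divff ?mulr1 ?mul1r//.
    by rewrite circ_neq// rnorm0.
  move=> Ig; have := circle_intD cu cphi; rewrite Ig.
  rewrite [X in circle_int X](_ : _ = fun=> b); last first.
    by apply/funext => t; rewrite /u subrK.
  by rewrite circle_int_cst => /eqP; rewrite -subr_eq subrr => /eqP.
have upi : u pi = 0.
  apply: circle_int_eq0 => //; rewrite pi_gt0 mulr_natl mulr2n ltrDl pi_gt0 //.
have zE : a * circ r pi = z.
  rewrite /a /circ cospi sinpi mulrN1 mulr0 (_ : (- r) +i* 0 = - r%:C).
    by rewrite mulrN mulNr mulNr opprK divfK.
  by apply/eqP; rewrite eq_complex/= oppr0 !eqxx.
apply: (strictly_convex_functional nE scE phi1).
- by rewrite gb.
- by rewrite gb//; move: upi => /eqP; rewrite subr_eq0 zE => /eqP.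
- by rewrite gb// -b1 phig.
Qed.

End ConstantNorm.

(** * The little Bloch space: derivatives, monomials and peaking functions *)

Section BlochDerivative.
Context {R : realType} (E : normedModType R[i]).
Implicit Types f g : B0 E.

(** Outside the disk the value is 0, which makes bderiv w linear for every w. *)
Definition bderiv (w : R[i]) (f : B0 E) : E :=
  if `|w| < 1 then derive1 (f : R[i] -> E) w else 0.

Lemma disk_rnorm (w : R[i]) : (`|w| < 1) = (rnorm w < 1).
Proof. by rewrite rnorm_lt. Qed.

Lemma bderivE w f : rnorm w < 1 -> bderiv w f = derive1 (f : R[i] -> E) w.
Proof. by rewrite -disk_rnorm /bderiv => ->. Qed.

Lemma bderiv_is_linear w : linear (bderiv w).
Proof.
move=> a f g; rewrite /bderiv; case: ifP => w1; last by rewrite scaler0 addr0.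
have Pf := lb_analytic (B0P f) w1; have Pg := lb_analytic (B0P g) w1.
rewrite !derive1E -[B0_val (a *: f + g)]/(a *: B0_val f + B0_val g).
have Pa : derivable ((a *: B0_val f) : R[i]^o -> E) w 1 by exact: derivableZ.
by rewrite (deriveD Pa Pg) (deriveZ a Pf).
Qed.

HB.instance Definition _ w :=
  GRing.isLinear.Build R[i] (B0 E) E *:%R (bderiv w) (bderiv_is_linear w).

Lemma bloch_rnorm f : rnorm f = bloch_norm f.
Proof. by apply: complexI; rewrite rnormE. Qed.

Lemma bloch_weight_rnorm f w : rnorm w < 1 ->
  bloch_weight f w = (1 - rnorm w ^+ 2) * rnorm (bderiv w f).
Proof.
move=> w1; apply: complexI; rewrite bloch_weightE bderivE// rmorphM/= rmorphB/=.
by rewrite rmorph1 rmorphXn/= !rnormE.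
Qed.

Lemma weight_gt0 (w : R[i]) : rnorm w < 1 -> 0 < 1 - rnorm w ^+ 2.
Proof. by move=> w1; rewrite subr_gt0 exprn_ilt1 ?rnorm_ge0. Qed.

Lemma bderiv_le f w : rnorm w < 1 ->
  (1 - rnorm w ^+ 2) * rnorm (bderiv w f) <= rnorm f.
Proof.
by move=> w1; rewrite -bloch_weight_rnorm// bloch_rnorm bloch_weight_le// diskE.
Qed.

Lemma bderiv_bounded f w : rnorm w < 1 ->
  rnorm (bderiv w f) <= (1 - rnorm w ^+ 2)^-1 * rnorm f.
Proof.
by move=> w1; rewrite mulrC ler_pdivlMr ?weight_gt0// mulrC bderiv_le.
Qed.

Lemma bloch_rnorm_le f (M : R) :
  (forall w, rnorm w < 1 -> (1 - rnorm w ^+ 2) * rnorm (bderiv w f) <= M) ->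
  rnorm f <= M.
Proof.
move=> H; rewrite bloch_rnorm; apply: bloch_norm_le => z /diskE z1.
by rewrite bloch_weight_rnorm// H.
Qed.

Lemma bderiv_inj f g : (forall w, rnorm w < 1 -> bderiv w f = bderiv w g) -> f = g.
Proof.
move=> fg; apply/eqP; rewrite -subr_eq0; apply/eqP/rnorm_eq0.
apply/eqP; rewrite eq_le rnorm_ge0 andbT; apply: bloch_rnorm_le => w w1.
by rewrite linearB /= fg// subrr rnorm0 mulr0.
Qed.

Lemma bloch_holomorphic f : holomorphic (f : R[i] -> E) (bderiv ^~ f).
Proof.
split=> [z z1|r r1].
  rewrite bderivE//; apply/complex_derivP; apply: DeriveDef.
    by apply: (lb_analytic (B0P f)); rewrite diskE.
  by rewrite derive1E.
have m0 : 0 <= Num.max r 0 by rewrite le_max lexx orbT.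
have m1 : Num.max r 0 < 1 by rewrite gt_max r1 ltr01.
exists ((1 - Num.max r 0 ^+ 2)^-1 * rnorm f) => z zr.
have zm : rnorm z <= Num.max r 0 by rewrite le_max zr.
apply: (le_trans (bderiv_bounded f (le_lt_trans zm m1))).
rewrite ler_wpM2r ?rnorm_ge0// lef_pV2 ?posrE ?weight_gt0 ?(le_lt_trans zm)//.
  by rewrite lerD2l lerN2 lerXn2r ?nnegrE ?rnorm_ge0.
by rewrite subr_gt0 exprn_ilt1.
Qed.

End BlochDerivative.

Section ScalarElements.
Context {R : realType} (E : normedModType R[i]).

(** A primitive p of a bounded function p' on the disk: p x is then in the
    little Bloch space for every vector x, since the weight 1 - |z|^2 tends
    to 0. *)
Definition bounded_primitive (p p' : R[i] -> R[i]) : Prop :=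
  [/\ forall z, rnorm z < 1 -> complex_deriv (p : R[i] -> R[i]^o) z (p' z),
      p 0 = 0 & exists M : R, forall z, rnorm z < 1 -> rnorm (p' z) <= M].

Definition tensor_fun (p : R[i] -> R[i]) (x : E) (z : R[i]) : E :=
  if `|z| < 1 then p z *: x else 0.

Lemma tensor_fun_deriv p p' x z : bounded_primitive p p' -> rnorm z < 1 ->
  complex_deriv (tensor_fun p x) z (p' z *: x).
Proof.
move=> [pd _ _] z1 e e0; have [d d0 H] := complex_derivZl x (pd z z1) e0.
exists (Num.min d (1 - rnorm z)); first by rewrite lt_min d0 subr_gt0.
move=> h; rewrite lt_min => /andP[/H h1 h2]; rewrite /tensor_fun !disk_rnorm z1.
by rewrite (_ : _ < 1 = true) //; have := rnormD z h; lra.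
Qed.

Lemma tensor_fun_derive1 p p' x z : bounded_primitive p p' -> rnorm z < 1 ->
  derive1 (tensor_fun p x) z = p' z *: x.
Proof.
by move=> bp z1; rewrite derive1E; have /complex_derivP[] := tensor_fun_deriv x bp z1.
Qed.

Lemma tensor_little_bloch p p' x : bounded_primitive p p' ->
  tensor_fun p x \in little_bloch (E := E).
Proof.
move=> bp; have [pd p0 [M HM]] := bp; apply/little_blochP.
have wE z : rnorm z < 1 -> bloch_weight (tensor_fun p x) z =
    (1 - rnorm z ^+ 2) * (rnorm (p' z) * rnorm x).
  move=> z1; apply: complexI; rewrite bloch_weightE (tensor_fun_derive1 x bp z1).
  by rewrite !rmorphM/= rmorphB/= rmorph1 rmorphXn/= !rnormE normrZ.
have M0 : 0 <= M by rewrite (le_trans (rnorm_ge0 _) (HM 0 _))// rnorm0.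
pose B := M * rnorm x + 1.
have B0 : 0 < B by rewrite ltr_wpDl// mulr_ge0// rnorm_ge0.
have wB z : rnorm z < 1 -> bloch_weight (tensor_fun p x) z <= (1 - rnorm z ^+ 2) * B.
  move=> z1; rewrite wE// ler_wpM2l ?(ltW (weight_gt0 _))//.
  rewrite (@le_trans _ _ (M * rnorm x)) ?lerDl//.
  by rewrite ler_wpM2r ?rnorm_ge0 ?HM.
split.
- by move=> z /negP nz; rewrite /tensor_fun (negbTE nz).
- move=> z /diskE z1.
  by have /complex_derivP[] := tensor_fun_deriv x bp z1.
- by rewrite /tensor_fun normr0 ltr01 p0 scale0r.
- exists B => z /diskE z1; apply: (le_trans (wB z z1)).
  by rewrite ler_piMl ?(ltW B0)// lerBlDr lerDl exprn_ge0 ?rnorm_ge0.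
- apply/cvgrPdist_le => e e0; exists (1 - e / (2 * B)).
    by rewrite /= ltrBlDr ltrDl divr_gt0// mulr_gt0.
  move=> z /= /andP[]; rewrite -rnormE ltcR (ltcR _ 1) => rz z1.
  rewrite sub0r normrN ger0_norm; last by rewrite bloch_weight_ge0// diskE.
  apply: (le_trans (wB z z1)); have := rnorm_ge0 z => z0.
  have : 1 - rnorm z < e / (2 * B) by lra.
  rewrite ltr_pdivlMr ?mulr_gt0// => h.
  have -> : 1 - rnorm z ^+ 2 = (1 - rnorm z) * (1 + rnorm z) by ring.
  have : (1 - rnorm z) * (1 + rnorm z) <= (1 - rnorm z) * 2.
    by rewrite ler_wpM2l ?subr_ge0 ?(ltW z1)//; lra.
  move=> /(ler_wpM2r (ltW B0)) /le_trans; apply.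
  by rewrite -mulrA ltW.
Qed.

Definition tensor p p' (bp : bounded_primitive p p') (x : E) : B0 E :=
  MkB0 (tensor_little_bloch x bp).

Lemma bderiv_tensor p p' (bp : bounded_primitive p p') x z : rnorm z < 1 ->
  bderiv z (tensor bp x) = p' z *: x.
Proof. by move=> z1; rewrite bderivE// (tensor_fun_derive1 x bp z1). Qed.

Lemma tensor_is_linear p p' (bp : bounded_primitive p p') : linear (tensor bp).
Proof.
move=> a x y; apply: bderiv_inj => z z1; rewrite linearP /= !bderiv_tensor//.
by rewrite scalerDr !scalerA mulrC.
Qed.

HB.instance Definition _ p p' (bp : bounded_primitive p p') :=
  GRing.isLinear.Build R[i] E (B0 E) *:%R (tensor bp) (tensor_is_linear bp).

Lemma monomial_primitive n :
  bounded_primitive (fun z => n.+1%:R^-1 * z ^+ n.+1) (fun z => z ^+ n).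
Proof.
split; last 2 first.
- by rewrite expr0n mulr0.
- by exists 1 => z z1; rewrite rnormX exprn_ile1 ?rnorm_ge0// ltW.
move=> z _; have id : is_derive (z : R[i]^o) (1 : R[i]^o) (id : R[i]^o -> R[i]^o) 1.
  exact: is_derive_id.
have := @is_deriveX R[i] R[i]^o _ n.+1 _ _ _ id => /complex_derivP.
move=> /(complex_derivZ n.+1%:R^-1).
rewrite -[_ *: 1]/(_ * 1) mulr1 -[_ *: _]/(_ * _) mulKf ?pnatr_eq0//.
by congr complex_deriv; apply/funext => y; rewrite exprfctE.
Qed.

Lemma conj_rnorm (w : R[i]) : rnorm (conjc w) = rnorm w.
Proof. by rewrite /rnorm normcJ. Qed.

Lemma peak_den_ge (w z : R[i]) : rnorm w < 1 -> rnorm z < 1 ->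
  1 - rnorm w <= rnorm (1 - conjc w * z).
Proof.
move=> w1 z1; have := rnormD (1 - conjc w * z) (conjc w * z).
rewrite subrK rnorm1 rnormM conj_rnorm.
have : rnorm w * rnorm z <= rnorm w by rewrite ler_piMr ?rnorm_ge0// ltW.
lra.
Qed.

(** The derivative (1 - conj(w) z)^-2 is, up to a factor, that of the disk
    automorphism exchanging 0 and w. *)
Lemma peak_primitive (w : R[i]) : rnorm w < 1 ->
  bounded_primitive (fun z => z / (1 - conjc w * z)) (fun z => (1 - conjc w * z) ^- 2).
Proof.
move=> w1; have w10 : 0 < 1 - rnorm w by rewrite subr_gt0.
split; last 2 first.
- by rewrite mul0r.
- exists ((1 - rnorm w) ^- 2) => z z1; rewrite rnormV rnormX.
  have h := peak_den_ge w1 z1.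
  rewrite lef_pV2 ?posrE ?exprn_gt0// ?(lt_le_trans w10)//.
  by rewrite lerXn2r ?nnegrE ?rnorm_ge0// ltW.
move=> z z1 e e0.
have p0 : 0 < rnorm (1 - conjc w * z) by rewrite (lt_le_trans w10)// peak_den_ge.
have [c cE] : exists c, c = conjc w by eexists.
have c1 : rnorm c <= 1 by rewrite cE conj_rnorm ltW.
rewrite -cE in p0 *; have [u uE] : exists u, u = 1 - c * z by eexists.
rewrite -uE in p0; have u0 : u != 0.
  by apply/eqP => u0; move: p0; rewrite u0 rnorm0 ltxx.
exists (Num.min (rnorm u / 2) (e * rnorm u ^+ 3 / 2)).
  by rewrite lt_min !divr_gt0// mulr_gt0// exprn_gt0.
move=> h; rewrite lt_min => /andP[h1 h2].
have ch : rnorm (c * h) <= rnorm h by rewrite rnormM ler_piMl ?rnorm_ge0.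
have uh : rnorm u / 2 <= rnorm (u - c * h).
  have := rnormD (u - c * h) (c * h); rewrite subrK => ?; lra.
have uh0 : u - c * h != 0.
  by apply/eqP => uh0; move: uh; rewrite uh0 rnorm0 leNgt divr_gt0.
have dE : 1 - c * (z + h) = u - c * h by rewrite uE; ring.
rewrite (_ : _ - _ = h * (c * h / (u ^+ 2 * (u - c * h)))); last first.
  rewrite -[h *: _]/(h * _) dE -uE; have zE : c * z = 1 - u by rewrite uE; ring.
  have -> : (z + h) / (u - c * h) - z / u - h / u ^+ 2 =
      h * ((1 - u) * u + u ^+ 2 - (u - c * h)) / (u ^+ 2 * (u - c * h)).
    by rewrite -zE; field; rewrite u0 uh0.
  by field; rewrite u0 uh0.
rewrite rnormM mulrC ler_wpM2r ?rnorm_ge0// rnormM rnormV 2!rnormM rnormX.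
rewrite ler_pdivrMr; last by rewrite mulr_gt0 ?exprn_gt0// (lt_le_trans _ uh)// divr_gt0.
rewrite -rnormM; apply: (le_trans ch); apply: (le_trans (ltW h2)).
rewrite -mulrA ler_wpM2l ?(ltW e0)//.
by rewrite exprSr -mulrA ler_wpM2l// exprn_ge0// ltW.
Qed.

(** The identity behind the Schwarz-Pick lemma. *)
Lemma peak_identity (w z : R[i]) :
  rnorm (1 - conjc w * z) ^+ 2 =
  rnorm (z - w) ^+ 2 + (1 - rnorm z ^+ 2) * (1 - rnorm w ^+ 2).
Proof. by rewrite !rnorm_sqr; case: w z => [a b] [c d] /=; ring. Qed.

(** The factor 1/4 comes from |1 - conj(w) z| <= 2. *)
Lemma peak_weight_le (w z : R[i]) : rnorm w < 1 -> rnorm z < 1 ->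
  (1 - rnorm z ^+ 2) * rnorm ((1 - conjc w * z) ^- 2) <=
  (1 - rnorm (z - w) ^+ 2 / 4) / (1 - rnorm w ^+ 2).
Proof.
move=> w1 z1; rewrite rnormV rnormX; have W0 := weight_gt0 w1.
have Z0 := weight_gt0 z1; have := peak_identity w z.
have q0 : 0 < rnorm (1 - conjc w * z).
  by rewrite (lt_le_trans _ (peak_den_ge w1 z1))// subr_gt0.
have q2 : rnorm (1 - conjc w * z) <= 2.
  have := rnormB 1 (conjc w * z); rewrite rnorm1 rnormM conj_rnorm.
  have : rnorm w * rnorm z <= 1 by rewrite mulr_ile1 ?rnorm_ge0// ltW.
  lra.
have Q4 : rnorm (1 - conjc w * z) ^+ 2 <= 4.
  by rewrite (_ : 4 = 2 * 2) ?expr2 ?ler_pM ?(ltW q0)//; ring.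
have Q0 : 0 < rnorm (1 - conjc w * z) ^+ 2 by rewrite exprn_gt0.
have s0 : 0 <= rnorm (z - w) ^+ 2 by rewrite exprn_ge0 ?rnorm_ge0.
move: (rnorm (1 - conjc w * z) ^+ 2) (rnorm (z - w) ^+ 2) (1 - rnorm z ^+ 2)
  (1 - rnorm w ^+ 2) Q0 Q4 s0 W0 Z0 => Q s Z W Q0 Q4 s0 W0 Z0 QE.
rewrite ler_pdivlMr// mulrAC ler_pdivrMr//.
have -> : Z * W = Q - s by lra.
have : Q * s <= 4 * s by rewrite ler_wpM2r.
by rewrite mulrBl mul1r mulrAC; lra.
Qed.

End ScalarElements.

(** * Isometry groups and linear differential equations *)

Section Groups.
Context {R : realType}.
Implicit Types X E : normedModType R[i].

Lemma ler_bounded_operator X (A : {linear X -> X}) : bounded_operator A ->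
  exists2 K : R, 0 <= K & forall x, rnorm (A x) <= K * rnorm x.
Proof.
move=> [M HM]; exists `|M| => // x.
apply: (@le_trans _ _ (M * rnorm x)); last by rewrite ler_wpM2r ?rnorm_ge0 ?ler_norm.
by rewrite rnorm_le rmorphM/= rnormE.
Qed.

Lemma group_curve X (G : X -> X) (U : R -> X -> X) : c0_isometry_group U ->
  generates U G -> forall x t, curve_deriv (fun s => U s x) t (G (U t x)).
Proof.
move=> cU gU x t e e0; have e0' : 0 < e%:C by rewrite (ltcR 0).
have /cvgrPdist_le /(_ _ e0')[d /= d0 H] := gU (U t x).
exists d => // h hd; have [->|h0] := eqVneq h 0.
  by rewrite addr0 subrr scale0r subrr rnorm0 normr0 mulr0.
have h0' : 0 < `|h| by rewrite normr_gt0.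
have hC0 : h%:C != 0 :> R[i] by rewrite (fmorph_eq0 (real_complex R)).
have := H h; rewrite /ball_/= sub0r normrN => /(_ hd h0); rewrite -rnorm_le.
have -> : G (U t x) - (h^-1)%:C *: (U h (U t x) - U t x) =
    - ((h^-1)%:C *: (U (t + h) x - U t x - h%:C *: G (U t x))).
  rewrite (addrC t) (c0_add cU) [in RHS]scalerBr scalerA fmorphV mulVf// scale1r.
  by rewrite opprB.
by rewrite rnormN rnormZ rnorm_real normfV mulrC ler_pdivrMr.
Qed.

Lemma curve_deriv_generates X (u : R -> X) v : curve_deriv u 0 v ->
  (h^-1)%:C *: (u h - u 0) @[h --> (0 : R)^'] --> v.
Proof.
move=> uv; apply/cvgrPdist_le => e e0.
have eE : (complex.Re e)%:C = e by exact: RRe_real (gtr0_real e0).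
have e0' : 0 < complex.Re e by rewrite -(ltcR 0) eE.
have [d d0 H] := uv _ e0'; exists d => //= h; rewrite /ball_/= sub0r normrN => hd h0.
have h0' : 0 < `|h| by rewrite normr_gt0.
have hC0 : h%:C != 0 :> R[i] by rewrite (fmorph_eq0 (real_complex R)).
rewrite -eE -rnorm_le.
have -> : v - (h^-1)%:C *: (u h - u 0) =
    - ((h^-1)%:C *: (u (0 + h) - u 0 - h%:C *: v)).
  by rewrite add0r [in RHS]scalerBr scalerA fmorphV mulVf// scale1r opprB.
rewrite rnormN rnormZ rnorm_real normfV mulrC ler_pdivrMr//; exact: H.
Qed.

Lemma curve_deriv_cst X (u : R -> X) t v :
  curve_deriv u t v -> (forall s, u s = u t) -> v = 0.
Proof.
move=> uv uc; apply: rnorm_eq0; apply/eqP; rewrite eq_le rnorm_ge0 andbT.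
apply/ler_addgt0Pr => e e0; rewrite add0r.
have [d d0 H] := uv _ e0; have d2 : 0 < d / 2 by rewrite divr_gt0.
have := H (d / 2); rewrite uc subrr sub0r rnormN rnormZ rnorm_real ger0_norm ?(ltW d2)//.
have dd : d / 2 < d by rewrite ltr_pdivrMr// mulr_natr mulr2n ltrDl.
by move=> /(_ dd); rewrite [e * _]mulrC ler_pM2l.
Qed.

Lemma complex_deriv_bounded_linear X E (T : {linear X -> E}) (M : R) f z v :
  (forall x, rnorm (T x) <= M * rnorm x) ->
  complex_deriv f z v -> complex_deriv (T \o f) z (T v).
Proof.
move=> TM fv e e0.
have M1 : 0 < `|M| + 1 by rewrite ltr_wpDl.
have [d d0 H] := fv _ (divr_gt0 e0 M1); exists d => // h /H h1.
rewrite /= -linearZ -!linearB; apply: (le_trans (TM _)).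
have := ler_wpM2l (ltW M1) h1; rewrite mulrA mulrCA divff ?mulr1 ?gt_eqF//.
apply: le_trans; rewrite ler_wpM2r ?rnorm_ge0//.
by rewrite (le_trans (ler_norm _))// lerDl.
Qed.

(** On an interval of length a with K a <= 1/2 around a zero of u, the mean value
    inequality improves any bound on u by a factor 1/2; so u vanishes on it, and
    such intervals cover the line. *)
Lemma gronwall_zero E (u du : R -> E) (K B : R) : norming E -> 0 <= K ->
  (forall t, curve_deriv u t (du t)) ->
  (forall t, rnorm (du t) <= K * rnorm (u t)) ->
  (forall t, rnorm (u t) <= B) -> u 0 = 0 -> forall t, u t = 0.
Proof.
move=> nE K0 ud duK uB u0; pose a := (2 * (K + 1))^-1.
have K1 : 0 < K + 1 by rewrite ltr_wpDl.
have a0 : 0 < a by rewrite invr_gt0 mulr_gt0.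
have aK : K * a <= 2^-1.
  rewrite /a invfM mulrCA ger_pMr ?invr_gt0// ler_pdivrMr// mul1r lerDl//.
have B0 : 0 <= B by rewrite (le_trans (rnorm_ge0 _) (uB 0)).
have local t0 t : u t0 = 0 -> `|t - t0| <= a -> u t = 0.
  move=> ut0 ta.
  have H (n : nat) s : `|s - t0| <= a -> rnorm (u s) <= B / 2 ^+ n.
    elim: n s => [|n IH] s sa; first by rewrite expr0 divr1.
    have mv (x y : R) : x <= y -> y - x <= a ->
        (forall q, x <= q <= y -> `|q - t0| <= a) ->
        rnorm (u y - u x) <= B / 2 ^+ n.+1.
      move=> xy yxa qin.
      have Bn : 0 <= B / 2 ^+ n by rewrite divr_ge0// exprn_ge0.
      have := @curve_mean_value R E u du x y (K * (B / 2 ^+ n)) nE xy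
        (fun q _ => ud q) (fun q hq => le_trans (duK q) (ler_wpM2l K0 (IH q (qin q hq)))).
      move=> /le_trans; apply.
      apply: (@le_trans _ _ (K * (B / 2 ^+ n) * a)); first by rewrite ler_wpM2l ?mulr_ge0.
      by rewrite mulrAC exprS invfM (mulrCA B) ler_wpM2r.
    have [st|ts] := leP s t0.
      have := mv s t0 st; rewrite ut0 sub0r rnormN; apply.
        by move: sa; rewrite ler_norml; lra.
      by move=> q /andP[q1 q2]; move: sa; rewrite !ler_norml; lra.
    have := mv t0 s (ltW ts); rewrite ut0 subr0; apply.
      by move: sa; rewrite ler_norml; lra.
    by move=> q /andP[q1 q2]; move: sa; rewrite !ler_norml; lra.
  apply: rnorm_eq0; apply/eqP; rewrite eq_le rnorm_ge0 andbT leNgt; apply/negP => ut.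
  have := archi_boundP (divr_ge0 B0 (ltW ut)).
  rewrite ltr_pdivrMr// => h.
  have := H (Num.bound (B / rnorm (u t))) t ta.
  rewrite ler_pdivlMr ?exprn_gt0// leNgt => /negP; apply.
  apply: (lt_le_trans h); rewrite mulrC ler_wpM2l ?(ltW ut)//.
  by rewrite -natrX ler_nat ltnW// ltn_expl.
have H (n : nat) t : `|t| <= n%:R * a -> u t = 0.
  elim: n t => [|n IH] t; first by rewrite mul0r normr_le0 => /eqP ->.
  move=> tn; have n1 : (0 : R) < n.+1%:R by rewrite ltr0n.
  apply: (@local (t * (n%:R / n.+1%:R))).
    apply: IH; rewrite normrM [`|_ / _|]ger0_norm ?divr_ge0//.
    by rewrite mulrCA ler_wpM2l// ler_pdivrMr// mulrC.
  rewrite -[t in t - _]mulr1 -mulrBr normrM.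
  rewrite (_ : 1 - n%:R / n.+1%:R = n.+1%:R^-1); last first.
    by rewrite -natr1; field; rewrite natr1 pnatr_eq0.
  by rewrite [`|_^-1|]ger0_norm ?invr_ge0 ?ler0n// ler_pdivrMr// mulrC.
move=> t; apply: (H (Num.bound (`|t| / a))).
rewrite -ler_pdivrMr// ltW//; apply: archi_boundP.
by rewrite divr_ge0// ltW.
Qed.

End Groups.

(** * Hermitian operators at a peak *)

Section HermitianOnBloch.
Context {R : realType} (E : completeNormedModType R[i]).
Hypothesis nE : norming E.
Variable A : {linear B0 E -> B0 E}.
Variable U : R -> B0 E -> B0 E.
Hypothesis cU : c0_isometry_group U.
Hypothesis Ucurve : forall f t, curve_deriv (fun s => U s f) t ('i *: A (U t f)).

Let URn t f : rnorm (U t f) = rnorm f.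
Proof. by rewrite /rnorm (c0_isometry cU). Qed.

Let bderivDZ w (f : B0 E) (a : R[i]) (g : B0 E) :
  bderiv w (f + a *: g) = bderiv w f + a *: bderiv w g.
Proof. by rewrite linearD linearZ. Qed.

Let bderiv_curve w (w1 : rnorm w < 1) f t :
  curve_deriv (fun s => bderiv w (U s f)) t ('i *: bderiv w (A (U t f))).
Proof.
rewrite -linearZ.
exact: (@curve_deriv_bounded_linear R (B0 E) E (bderiv w) _ _ _ _
  (fun f => bderiv_bounded f w1) (Ucurve f t)).
Qed.

(** t |-> Re phi(D_w (U_t f)) is maximal at t = 0 and its derivative there is
    - Im phi(D_w (A f)). *)
Lemma peaking_numerical_real f w (phi : {scalar E}) : rnorm w < 1 ->
  contraction phi ->
  rnorm f <= (1 - rnorm w ^+ 2) * complex.Re (phi (bderiv w f)) ->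
  complex.Im (phi (bderiv w (A f))) = 0.
Proof.
move=> w1 phi1 fw; pose N t := complex.Re (phi (bderiv w (U t f))).
have dN t : is_derive t (1 : R) N (complex.Re (phi ('i *: bderiv w (A (U t f))))).
  apply: is_derive_Re; exact: (@curve_deriv_bounded_linear R E R[i]^o phi 1 _ _ _
    (contraction_rnorm phi1) (bderiv_curve w1 f t)).
have N0 t : N t <= N 0.
  rewrite /N (c0_id cU) -(ler_pM2l (weight_gt0 w1)); apply: le_trans fw.
  rewrite -(URn t f); apply: le_trans (bderiv_le _ w1).
  by rewrite ler_wpM2l ?(ltW (weight_gt0 w1))// contraction_Re.
have [|t _||t _|_] := @derive1_at_max R N (-1) 1 0.
- by rewrite lerNl; lra.
- by have [] := dN t.
- by rewrite in_itv/= ltr01 andbT ltrNl oppr0 ltr01.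
- exact: N0.
have [_ ->] := dN 0; rewrite (c0_id cU).
have -> : phi ('i *: bderiv w (A f)) = 'i * phi (bderiv w (A f)) by rewrite linearZ.
case: (phi _) => a b /= /eqP.
by rewrite mul0r mul1r sub0r oppr_eq0 => /eqP.
Qed.

Let peak w (w1 : rnorm w < 1) : E -> B0 E := tensor (peak_primitive w1).

Let peak_center w : rnorm w < 1 ->
  (1 - conjc w * w) ^- 2 = ((1 - rnorm w ^+ 2) ^- 2)%:C :> R[i].
Proof.
move=> w1; rewrite fmorphV rmorphXn/= rmorphB/= rmorph1 rmorphXn/= rnormE.
by rewrite sqr_normc (mulrC w).
Qed.

Lemma bderiv_peak w (w1 : rnorm w < 1) x :
  bderiv w (peak w1 x) = ((1 - rnorm w ^+ 2) ^- 2)%:C *: x.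
Proof. by rewrite /peak bderiv_tensor// peak_center. Qed.

Lemma peak_weight w (w1 : rnorm w < 1) x z : rnorm z < 1 ->
  (1 - rnorm z ^+ 2) * rnorm (bderiv z (peak w1 x)) <=
  (1 - rnorm (z - w) ^+ 2 / 4) / (1 - rnorm w ^+ 2) * rnorm x.
Proof.
move=> z1; rewrite /peak bderiv_tensor// rnormZ mulrA.
by rewrite ler_wpM2r ?rnorm_ge0 ?peak_weight_le.
Qed.

(** Let x = D_w (A g).  The peaking function of x, and the same function plus
    i e g, both attain their norms at w through a functional phi that norms x.
    The difference of the two real numbers obtained is i e phi(x) = i e |x|. *)
Lemma derivative_kernel (C : R) g w : rnorm w < 1 ->
  (forall z, rnorm z < 1 ->
    (1 - rnorm z ^+ 2) * rnorm (bderiv z g) <= C * rnorm (z - w) ^+ 2) ->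
  bderiv w (A g) = 0.
Proof.
move=> w1 gC; have W0 := weight_gt0 w1; set W := 1 - rnorm w ^+ 2 in W0.
have [x xE] : exists x, x = bderiv w (A g) by eexists.
rewrite -xE; apply: rnorm_eq0; have X0 := rnorm_ge0 x.
have [phi [phi1 phix]] := nE x.
have gw : bderiv w g = 0.
  apply: rnorm_eq0; apply/eqP; rewrite eq_le rnorm_ge0 andbT.
  by rewrite -(pmulr_rle0 _ W0) (le_trans (gC w w1))// subrr rnorm0 expr0n mulr0.
have C1 : 0 < `|C| + 1 by rewrite ltr_wpDl.
(* With this e the perturbation costs at most the margin |x| |z - w|^2 / (4 W)
   of the peaking function. *)
pose e := rnorm x / (4 * W * (`|C| + 1)).
have e0 : 0 <= e by rewrite divr_ge0 ?mulr_ge0 ?(ltW W0) ?(ltW C1).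
have eC : e * C <= rnorm x / (4 * W).
  have -> : rnorm x / (4 * W) = e * (`|C| + 1).
    by rewrite /e; field; rewrite !gt_eqF.
  by rewrite ler_wpM2l// (le_trans (ler_norm _))// lerDl.
have real (s : R) : 0 <= s <= e ->
    complex.Im (phi (bderiv w (A (peak w1 x + (s%:C * 'i) *: g)))) = 0.
  move=> /andP[s0 se]; apply: peaking_numerical_real => //.
  rewrite bderivDZ gw scaler0 addr0 bderiv_peak.
  have -> : phi (((1 - rnorm w ^+ 2) ^- 2)%:C *: x) = (W ^- 2 * rnorm x)%:C.
    by rewrite linearZ /= phix -rnormE rmorphM.
  rewrite /= -/W.
  have -> : W * (W ^- 2 * rnorm x) = rnorm x / W by field; rewrite gt_eqF.
  apply: bloch_rnorm_le => z z1; rewrite bderivDZ.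
  have Z0 := weight_gt0 z1.
  have := ler_wpM2l (ltW Z0) (rnormD (bderiv z (peak w1 x)) ((s%:C * 'i) *: bderiv z g)).
  move=> /le_trans; apply; rewrite mulrDr rnormZ rnormM rnorm_i rnorm_real mulr1.
  rewrite (ger0_norm s0); have P := peak_weight w1 x z1.
  have G : (1 - rnorm z ^+ 2) * (s * rnorm (bderiv z g)) <=
      rnorm x / (4 * W) * rnorm (z - w) ^+ 2.
    rewrite mulrCA; have := ler_wpM2l s0 (gC z z1) => /le_trans; apply.
    rewrite mulrA; have q0 : 0 <= rnorm (z - w) ^+ 2 by rewrite exprn_ge0 ?rnorm_ge0.
    rewrite ler_wpM2r//; have [c0|c0] := leP 0 C.
      by rewrite (le_trans _ eC)// ler_wpM2r.
    rewrite (@le_trans _ _ 0)//; first by rewrite mulr_ge0_le0 ?(ltW c0).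
    by rewrite divr_ge0// mulr_ge0// ltW.
  rewrite (le_trans (lerD P G))// -/W le_eqVlt; apply/orP; left; apply/eqP.
  by field; rewrite gt_eqF.
have h0 := real 0; have he := real e.
rewrite lexx e0 in h0; rewrite e0 lexx in he.
move: (h0 isT) (he isT); rewrite rmorph0 mul0r scale0r addr0 => {h0 he} h0.
have -> : phi (bderiv w (A (peak w1 x + (e%:C * 'i) *: g))) =
    phi (bderiv w (A (peak w1 x))) + (e%:C * 'i) * phi x.
  by rewrite [A _]linearD [A (_ *: _)]linearZ bderivDZ -xE linearD linearZ.
rewrite phix -rnormE.
case: (phi _) h0 => a b /= -> h; have eX : e * rnorm x = 0.
  by move: h; rewrite ?(mulr0, mul0r, mulr1, add0r, addr0, subr0).
have D0 : 4 * W * (`|C| + 1) != 0 by rewrite gt_eqF// !mulr_gt0.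
by move/eqP: eX; rewrite /e !mulf_eq0 invr_eq0 (negbTE D0) orbF orbb => /eqP.
Qed.

End HermitianOnBloch.

(** * Bounded first-order operators are of order zero *)

Local Notation mon n := (tensor (monomial_primitive n)).

Section FirstOrderOperators.
Context {R : realType} (E : completeNormedModType R[i]).
Hypothesis nE : norming E.
Variable A : {linear B0 E -> B0 E}.
Variable K : R.
Hypotheses (K0 : 0 <= K) (AK : forall f, rnorm (A f) <= K * rnorm f).
Hypothesis Aker : forall (C : R) g w, rnorm w < 1 ->
  (forall z, rnorm z < 1 ->
    (1 - rnorm z ^+ 2) * rnorm (bderiv z g) <= C * rnorm (z - w) ^+ 2) ->
  bderiv w (A g) = 0.

Implicit Types (f g : B0 E) (x y : E) (w z : R[i]).

Lemma bderiv_mon n x z : rnorm z < 1 -> bderiv z (mon n x) = z ^+ n *: x.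
Proof. exact: bderiv_tensor. Qed.

Lemma bderiv_mon0 x z : rnorm z < 1 -> bderiv z (mon 0%N x) = x.
Proof. by move=> z1; rewrite bderiv_mon// expr0 scale1r. Qed.

(** The coefficient M_w of f''(w) in D_w (A f): the image under D_w A of the
    function with derivative (z - w) y. *)
Definition derivative_symbol w y : E :=
  bderiv w (A (mon 1%N y)) - w *: bderiv w (A (mon 0%N y)).

(** The function f minus those with derivatives f'(w) and (z - w) f''(w) has a
    derivative of size O(|z - w|^2) near w by Taylor's formula, and everywhere
    because the weight is bounded. *)
Lemma first_order f w y : rnorm w < 1 ->
  complex_deriv (fun z => bderiv z f) w y ->
  bderiv w (A f) = bderiv w (A (mon 0%N (bderiv w f))) + derivative_symbol w y.
Proof.
move=> w1 fy.
have fh := bloch_holomorphic f.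
have yE := complex_deriv_uniq fy ((holomorphic_derive nE fh).1 w w1).
pose g := f - mon 0%N (bderiv w f) - (mon 1%N y - w *: mon 0%N y).
have gE z : rnorm z < 1 ->
    bderiv z g = bderiv z f - bderiv w f - (z - w) *: y.
  move=> z1; rewrite /g !linearB linearZ /= !bderiv_mon0// bderiv_mon// expr1.
  by rewrite scalerBl opprD.
suff : bderiv w (A g) = 0.
  rewrite /g !linearB linearZ /= [bderiv w (w *: _)]linearZ -opprD -addrA -opprD.
  by move=> /eqP; rewrite subr_eq0 => /eqP.
pose rho := (1 + rnorm w) / 2.
have rho0 : 0 <= rho by rewrite divr_ge0// addr_ge0// rnorm_ge0.
have rho1 : rho < 1 by rewrite /rho; lra.
have wr : rnorm w < rho by rewrite /rho; lra.
have [C C0 HC] := second_order_estimate nE fh rho0 rho1.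
have d0 : 0 < (rho - rnorm w) ^+ 2 by rewrite exprn_gt0// subr_gt0.
pose B := C + rnorm g / (rho - rnorm w) ^+ 2.
have B1 : 0 <= rnorm g / (rho - rnorm w) ^+ 2 by rewrite divr_ge0 ?rnorm_ge0// ltW.
(* C serves near w, and ||g|| / (rho - |w|)^2 away from w. *)
apply: (Aker w1 (C := B)) => z z1; have q0 := exprn_ge0 2 (rnorm_ge0 (z - w)).
have [zr|rz] := leP (rnorm z) rho.
  have [H _] := HC w z (ltW wr) zr.
  rewrite gE// yE; apply: (@le_trans _ _ (C * rnorm (z - w) ^+ 2)); last first.
    by rewrite ler_wpM2r// lerDl.
  apply: le_trans H; rewrite ler_piMl ?rnorm_ge0//.
  by rewrite lerBlDr lerDl exprn_ge0 ?rnorm_ge0.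
apply: (le_trans (bderiv_le g z1)).
apply: (@le_trans _ _ (rnorm g / (rho - rnorm w) ^+ 2 * rnorm (z - w) ^+ 2)).
  rewrite mulrAC ler_pdivlMr// ler_wpM2l ?rnorm_ge0//.
  rewrite lerXn2r ?nnegrE ?rnorm_ge0 ?subr_ge0 ?(ltW wr)//.
  by have := rnormD (z - w) w; rewrite subrK; lra.
by rewrite ler_wpM2r// lerDr.
Qed.

Lemma complex_derivXM (u : R[i] -> E) w v : complex_deriv u w v ->
  complex_deriv (fun z => z *: u z) w (u w + w *: v).
Proof.
move=> uv e e0.
have A0 : 0 < rnorm w + 1 by rewrite ltr_wpDl ?rnorm_ge0.
have B0 : 0 < rnorm v + 1 by rewrite ltr_wpDl ?rnorm_ge0.
have [d d0 H] := uv _ (divr_gt0 (divr_gt0 e0 (ltr0Sn R 1)) A0).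
have [d' d'0 H'] := uv _ ltr01.
exists (Num.min d (Num.min d' (e / 2 / (rnorm v + 1)))).
  by rewrite !lt_min d0 d'0 !divr_gt0.
move=> h; rewrite !lt_min => /and3P[/H h1 /H' h2 h3].
have [p pE] : exists p, p = u (w + h) - u w by eexists.
rewrite -pE in h1 h2.
have -> : (w + h) *: u (w + h) - w *: u w - h *: (u w + w *: v) =
    w *: (p - h *: v) + h *: p.
  have -> : u (w + h) = p + u w by rewrite pE subrK.
  rewrite scalerDl scalerBr !scalerDr !scalerA (mulrC h w).
  by rewrite [X in X - _](addrAC _ (_ + _)) addrK opprD !addrA addrK addrAC.
apply: (le_trans (rnormD _ _)); rewrite !rnormZ (splitr e) mulrDl lerD//.
  have := ler_wpM2l (rnorm_ge0 w) h1 => /le_trans; apply.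
  rewrite mulrA ler_wpM2r ?rnorm_ge0// mulrCA ger_pMr ?divr_gt0//.
  by rewrite ler_pdivrMr// mul1r lerDl.
rewrite mulrC ler_wpM2r ?rnorm_ge0//.
have := rnormD (p - h *: v) (h *: v); rewrite subrK rnormZ => h4.
move: h3; rewrite ltr_pdivlMr// => h3; lra.
Qed.

Lemma derivative_symbol_holomorphic y : exists s' : R[i] -> E,
  holomorphic (fun w => derivative_symbol w y) s'.
Proof.
have h1 := bloch_holomorphic (A (mon 1%N y)).
have h0 := bloch_holomorphic (A (mon 0%N y)).
have d1 := holomorphic_derive nE h1; have d0 := holomorphic_derive nE h0.
set u1 := fun z => bderiv z (A (mon 1%N y)) in h1 d1.
set u0 := fun z => bderiv z (A (mon 0%N y)) in h0 d0.
exists (fun w => second_deriv u1 w + (-1) *: (u0 w + w *: second_deriv u0 w)).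
split=> [w w1|r r1].
  have := complex_derivD (d1.1 w w1) (complex_derivZ (-1) (complex_derivXM (d0.1 w w1))).
  congr complex_deriv; apply/funext => z.
  by rewrite scaleN1r.
have [M1 HM1] := d1.2 r r1; have [M2 HM2] := d0.2 r r1; have [M3 HM3] := h0.2 r r1.
exists (M1 + (M3 + M2)) => w wr.
apply: (le_trans (rnormD _ _)); rewrite lerD ?HM1// scaleN1r rnormN.
apply: (le_trans (rnormD _ _)); rewrite lerD ?HM3// rnormZ.
rewrite (le_trans _ (HM2 w wr))// ler_piMl ?rnorm_ge0//.
by rewrite (le_trans wr)// ltW.
Qed.

(** The induction runs on the stronger inequality
    (k + 1) (1 - s) s^k + s^(k + 1) <= 1. *)
Lemma weight_power_le (s : R) k : 0 <= s -> s <= 1 ->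
  k.+1%:R * ((1 - s) * s ^+ k) <= 1.
Proof.
move=> s0 s1; suff : k.+1%:R * ((1 - s) * s ^+ k) + s ^+ k.+1 <= 1.
  by apply: le_trans; rewrite lerDl exprn_ge0.
elim: k => [|k IH]; first by rewrite mul1r expr0 expr1 mulr1 subrK.
have sk : s ^+ k.+1 <= 1 by rewrite exprn_ile1.
have := ler_wpM2l s0 IH; have : (1 - s) * s ^+ k.+1 <= (1 - s) * 1.
  by rewrite ler_wpM2l ?subr_ge0.
rewrite -[k.+2%:R]natr1 !exprS; lra.
Qed.

(** Even exponents make the weight a polynomial in |w|^2. *)
Lemma rnorm_mon_even k y : k.+1%:R * rnorm (mon k.*2 y) <= rnorm y.
Proof.
have k0 : 0 < k.+1%:R :> R by rewrite ltr0n.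
rewrite mulrC -ler_pdivlMr//; apply: bloch_rnorm_le => w w1.
rewrite bderiv_mon// rnormZ rnormX -muln2 mulnC exprM mulrA.
rewrite ler_pdivlMr// mulrAC mulrC ler_piMr ?rnorm_ge0// mulrC.
apply: weight_power_le; first by rewrite exprn_ge0 ?rnorm_ge0.
by rewrite exprn_ile1 ?rnorm_ge0// ltW.
Qed.

Lemma complex_deriv_near (u v : R[i] -> E) w x : rnorm w < 1 ->
  (forall z, rnorm z < 1 -> u z = v z) ->
  complex_deriv v w x -> complex_deriv u w x.
Proof.
move=> w1 uv vx e e0; have [d d0 H] := vx e e0.
exists (Num.min d (1 - rnorm w)); first by rewrite lt_min d0 subr_gt0.
move=> h; rewrite lt_min => /andP[/H h1 h2]; rewrite !uv//.
by have := rnormD w h; lra.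
Qed.

Lemma image_mon n w y : rnorm w < 1 -> bderiv w (A (mon n.+1 y)) =
  w ^+ n.+1 *: bderiv w (A (mon 0%N y)) + (n.+1%:R * w ^+ n) *: derivative_symbol w y.
Proof.
move=> w1; have dm : complex_deriv (fun z => bderiv z (mon n.+1 y)) w
    ((n.+1%:R * w ^+ n) *: y).
  apply: (@complex_deriv_near _ (fun z => z ^+ n.+1 *: y)) => //.
    by move=> z; exact: bderiv_mon.
  have [pd _ _] := monomial_primitive (R := R) n.
  have := complex_derivZl y (complex_derivZ n.+1%:R (pd w w1)).
  congr complex_deriv; apply/funext => z.
  by rewrite /= -[n.+1%:R *: (_ * _)]/(n.+1%:R * (_ * _)) mulVKf ?pnatr_eq0.
rewrite (first_order w1 dm) bderiv_mon// !linearZ /= /derivative_symbol.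
by rewrite !linearZ /= scalerDr !scalerA (mulrC w).
Qed.

Lemma bernoulli_ineq (t : R) n : 0 <= t -> t <= 1 -> 1 - n%:R * t <= (1 - t) ^+ n.
Proof.
move=> t0 t1; elim: n => [|n IH]; first by rewrite mul0r subr0 expr0.
have t1' : 0 <= 1 - t by rewrite subr_ge0.
rewrite exprS; apply: le_trans (ler_wpM2l t1' IH).
have : 0 <= n%:R * t * t by rewrite !mulr_ge0.
rewrite -natr1; lra.
Qed.

(** The images of the monomials with derivatives z^(2k) y and z^(4k) y are
    bounded by a multiple of K |y| at these radii, where the weight is
    comparable with 1 / k.  The combination that eliminates L_w y contains
    2k w^(4k - 1) M_w y, and |w|^(4k) >= 1/2 by Bernoulli's inequality. *)
Lemma derivative_symbol_circle k w y : (0 < k)%N ->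
  rnorm w ^+ 2 = 1 - (4 * k.+1%:R)^-1 ->
  k%:R * rnorm (derivative_symbol w y) <= 8 * (K * rnorm y).
Proof.
move=> k0; have [t tE] : exists t : R, t = (4 * k.+1%:R)^-1 by eexists.
rewrite -tE => ws.
have kp : 0 < k.+1%:R :> R by rewrite ltr0n.
have t0 : 0 < t by rewrite tE invr_gt0 mulr_gt0.
have tk : t * k.+1%:R = 4^-1 by rewrite tE; field; rewrite gt_eqF.
have t1 : t <= 1.
  have : 1 <= k.+1%:R :> R by rewrite ler1n.
  by move=> /(ler_wpM2l (ltW t0)); rewrite tk; lra.
have w1 : rnorm w < 1.
  by rewrite -(@ltr_pXn2r _ 2) ?nnegrE ?rnorm_ge0// ws expr1n; lra.
have E1 n : (k <= n)%N -> rnorm (bderiv w (A (mon n.*2 y))) <= 4 * (K * rnorm y).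
  move=> kn; have W := bderiv_le (A (mon n.*2 y)) w1.
  rewrite ws opprB addrC subrK in W.
  have H1 := le_trans W (AK _).
  have H2 := ler_wpM2l K0 (rnorm_mon_even n y).
  have H3 : k.+1%:R * (K * rnorm (mon n.*2 y)) <= K * rnorm y.
    apply: le_trans H2; rewrite mulrCA ler_wpM2l// ler_wpM2r ?rnorm_ge0//.
    by rewrite ler_nat.
  have H4 := le_trans (ler_wpM2l (ltW kp) H1) H3.
  by move: H4; rewrite mulrCA mulrA tk; lra.
have EP := E1 k (leqnn k); have EQ := E1 k.*2 (ltac:(by rewrite -addnn leq_addr)).
have [a aE] : exists a, k.*2 = a.+1 by exists k.*2.-1; rewrite prednK// double_gt0.
have aE2 : k.*2.*2 = (a.*2.+1).+1 by rewrite aE doubleS.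
rewrite aE2 image_mon// in EQ; rewrite aE image_mon// in EP.
move: EP EQ; move: (bderiv w (A (mon 0 y))) (derivative_symbol w y) => L m.
set P := _ + _ => EP; set Q := _ + _ => EQ.
(* The terms in L cancel, and 4k - 2k = 2k copies of m are left. *)
have PQ : (a.+1%:R * w ^+ a.*2.+1) *: m = Q - w ^+ a.+1 *: P.
  rewrite /Q /P scalerDr !scalerA -exprD addSn addnS addnn opprD addrACA subrr add0r.
  rewrite -scalerBl; congr (_ *: m); rewrite mulrCA -exprD addSn addnn -mulrBl.
  by congr (_ * _); rewrite -doubleS -natrB -?addnn ?leq_addr// addnK.
have wle : rnorm (w ^+ a.+1) <= 1 by rewrite rnormX exprn_ile1 ?rnorm_ge0// ltW.
have H : rnorm ((a.+1%:R * w ^+ a.*2.+1) *: m) <= 8 * (K * rnorm y).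
  rewrite PQ; apply: (le_trans (rnormB _ _)); rewrite rnormZ.
  have := ler_piMl (rnorm_ge0 P) wle; lra.
apply: le_trans H; rewrite rnormZ rnormM rnorm_nat rnormX ler_wpM2r ?rnorm_ge0//.
have B : 2^-1 <= rnorm w ^+ a.*2.+1.
  apply: (@le_trans _ _ (rnorm w ^+ a.*2.+2)); last first.
    by rewrite exprSr ler_piMr ?exprn_ge0 ?rnorm_ge0// ltW.
  rewrite -doubleS -muln2 mulnC exprM ws; apply: le_trans (bernoulli_ineq _ (ltW t0) t1).
  rewrite -aE -muln2 natrM; move: tk; rewrite -[k.+1%:R]natr1.
  have : 0 <= t * k%:R by rewrite mulr_ge0 ?ler0n ?(ltW t0).
  by nra.
apply: le_trans (ler_wpM2l (ler0n _ _) B).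
by rewrite -aE -muln2 natrM mulfK// pnatr_eq0.
Qed.

(** The symbol is holomorphic in w and is O(1 / k) on circles whose radii tend
    to 1, so Cauchy's estimate makes it vanish. *)
Lemma derivative_symbol_eq0 w y : rnorm w < 1 -> derivative_symbol w y = 0.
Proof.
move=> w1; have [s' hs] := derivative_symbol_holomorphic y.
apply: rnorm_eq0; apply/eqP; rewrite eq_le rnorm_ge0 andbT leNgt; apply/negP => m0.
set m := rnorm (derivative_symbol w y) in m0.
pose d := (1 - rnorm w) / 2; have d0 : 0 < d by rewrite divr_gt0// subr_gt0.
pose B := 8 * (K * rnorm y).
have B0 : 0 <= B by rewrite !mulr_ge0 ?rnorm_ge0.
have [k [k0 kd kB]] : exists k, [/\ (0 < k)%N, d^-1 < k%:R & B / (d * m) < k%:R].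
  exists (Num.bound (d^-1) + Num.bound (B / (d * m))).+1; split=> //.
    apply: (lt_le_trans (archi_boundP _)); first by rewrite invr_ge0 ltW.
    by rewrite ler_nat -addSn (leq_trans (leqnSn _))// leq_addr.
  apply: (lt_le_trans (archi_boundP _)); first by rewrite divr_ge0// mulr_ge0// ltW.
  by rewrite ler_nat -addnS (leq_trans (leqnSn _))// leq_addl.
have [t tE] : exists t : R, t = (4 * k.+1%:R)^-1 by eexists.
pose s : R := 1 - t; pose r := Num.sqrt s.
have kp : 0 < k%:R :> R by rewrite ltr0n.
have t4 : t <= d.
  rewrite tE -(invrK d) lef_pV2 ?posrE ?mulr_gt0 ?ltr0n ?invr_gt0//.
  by apply: (le_trans (ltW kd)); rewrite -[k.+1%:R]natr1; lra.
have t0 : 0 < t by rewrite tE invr_gt0 mulr_gt0 ?ltr0n.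
have n0 := rnorm_ge0 w.
have s0 : 0 <= s by rewrite /s; move: t4; rewrite /d; lra.
have s1 : s < 1 by rewrite /s; lra.
have r0 : 0 <= r by exact: sqrtr_ge0.
have rs : r ^+ 2 = s by rewrite sqr_sqrtr.
have r1 : r < 1 by rewrite -(@ltr_pXn2r _ 2) ?nnegrE// rs expr1n.
have sr : s <= r by rewrite -rs expr2 ler_piMl// ltW.
have dr : d <= r - rnorm w by move: sr t4; rewrite /s /d; lra.
have fS z : rnorm z = r -> rnorm (derivative_symbol z y) <= B / k%:R.
  move=> zr; rewrite ler_pdivlMr// mulrC; apply: derivative_symbol_circle => //.
  by rewrite zr rs /s tE.
have wr : rnorm w < r by move: dr d0; lra.
have := cauchy_estimate nE hs r0 r1 fS wr; apply/negP; rewrite -ltNge -/m.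
apply: (@le_lt_trans _ _ (d^-1 * (B / k%:R))).
  apply: ler_wpM2r; first by rewrite divr_ge0// ltW.
  have dr0 : 0 < r - rnorm w by rewrite subr_gt0.
  have rd : r / (r - rnorm w) <= 1 * d^-1.
    apply: ler_pM => //; [by rewrite invr_ge0 ltW|exact: ltW|].
    by rewrite lef_pV2 ?posrE.
  by rewrite mul1r in rd.
rewrite ltr_pdivrMr ?(mulr_gt0 d0 m0)// in kB.
rewrite mulrA ltr_pdivrMr// [_ * B]mulrC ltr_pdivrMr//.
by have -> : m * k%:R * d = k%:R * (d * m) by ring.
Qed.

Lemma zeroth_order f w : rnorm w < 1 ->
  bderiv w (A f) = bderiv w (A (mon 0%N (bderiv w f))).
Proof.
move=> w1; have fh := bloch_holomorphic f.
by rewrite (first_order w1 ((holomorphic_derive nE fh).1 w w1)) derivative_symbol_eq0// addr0.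
Qed.

End FirstOrderOperators.

(** * The isometry group acts fibrewise *)

Section HermitianSymbol.
Context {R : realType} (E : completeNormedModType R[i]).
Hypothesis nE : norming E.
Hypothesis scE : strictly_convex_space E.
Variable A : {linear B0 E -> B0 E}.
Variable K : R.
Hypotheses (K0 : 0 <= K) (AK : forall f, rnorm (A f) <= K * rnorm f).
Variable U : R -> B0 E -> B0 E.
Hypothesis cU : c0_isometry_group U.
Hypothesis Ucurve : forall f t, curve_deriv (fun s => U s f) t ('i *: A (U t f)).

Implicit Types (f g : B0 E) (x y : E) (w z : R[i]).

Let rnormU t f : rnorm (U t f) = rnorm f.
Proof. by rewrite /rnorm (c0_isometry cU). Qed.

Let A_zeroth_order f w : rnorm w < 1 ->
  bderiv w (A f) = bderiv w (A (mon 0%N (bderiv w f))).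
Proof.
apply: (zeroth_order nE K0 AK) => {f w}C g w.
exact: (derivative_kernel nE cU Ucurve).
Qed.

Lemma rnorm_mon0 x : rnorm (mon 0%N x) <= rnorm x.
Proof. by have := rnorm_mon_even 0 x; rewrite mul1r. Qed.

(** D_w (U_t f) solves a linear differential equation with initial value 0. *)
Lemma group_local f w t : rnorm w < 1 -> bderiv w f = 0 -> bderiv w (U t f) = 0.
Proof.
move=> w1 fw; have W0 := weight_gt0 w1.
have W0' : 0 <= (1 - rnorm w ^+ 2)^-1 by rewrite invr_ge0 ltW.
apply: (@gronwall_zero R E (fun s => bderiv w (U s f))
  (fun s => 'i *: bderiv w (A (U s f))) ((1 - rnorm w ^+ 2)^-1 * K)
  ((1 - rnorm w ^+ 2)^-1 * rnorm f) nE).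
- by rewrite mulr_ge0.
- move=> s; rewrite -linearZ.
  exact: (@curve_deriv_bounded_linear R (B0 E) E (bderiv w) _ _ _ _
    (fun f => bderiv_bounded f w1) (Ucurve f s)).
- move=> s; rewrite rnormZ rnorm_i mul1r A_zeroth_order//.
  apply: (le_trans (bderiv_bounded _ w1)); rewrite -mulrA ler_wpM2l//.
  by apply: (le_trans (AK _)); rewrite ler_wpM2l// rnorm_mon0.
- by move=> s; rewrite -(rnormU s f) bderiv_bounded.
- by rewrite (c0_id cU).
Qed.

Let U_sub t f g : U t (f - g) = U t f - U t g.
Proof.
have Ul := c0_linear cU t (-1) g f; rewrite !scaleN1r in Ul.
by rewrite addrC Ul addrC.
Qed.

Lemma group_zeroth_order f w t : rnorm w < 1 ->
  bderiv w (U t f) = bderiv w (U t (mon 0%N (bderiv w f))).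
Proof.
move=> w1; apply/eqP; rewrite -subr_eq0 -linearB /= -U_sub; apply/eqP.
by apply: group_local => //; rewrite linearB /= bderiv_mon0// subrr.
Qed.

(** The function with D_w f = x of least norm is a peaking function; its norm is
    (1 - |w|^2) |x|, and U_t preserves it. *)
Lemma group_contraction w t x : rnorm w < 1 ->
  rnorm (bderiv w (U t (mon 0%N x))) <= rnorm x.
Proof.
move=> w1; have W0 := weight_gt0 w1; set W := 1 - rnorm w ^+ 2 in W0.
pose f : B0 E := tensor (peak_primitive w1) ((W ^+ 2)%:C *: x).
have fw : bderiv w f = x.
  rewrite /f bderiv_peak -/W scalerA -rmorphM/= mulVf ?expf_neq0 ?gt_eqF//.
  by rewrite rmorph1 scale1r.
have fn : rnorm f <= W * rnorm x.

  apply: bloch_rnorm_le => z z1; apply: (le_trans (peak_weight w1 _ z1)).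
  rewrite rnormZ rnorm_real ger0_norm ?exprn_ge0 ?(ltW W0)// -/W mulrA.
  rewrite ler_wpM2r ?rnorm_ge0// expr2 mulrA divfK ?gt_eqF// ler_piMl ?(ltW W0)//.
  by rewrite lerBlDr lerDl divr_ge0 ?mulr_ge0 ?rnorm_ge0.
rewrite -(ler_pM2l W0); apply: le_trans fn; rewrite -(rnormU t f).
by apply: le_trans (bderiv_le _ w1); rewrite -/W (group_zeroth_order f t w1) fw.
Qed.

(** The inverse of e_t(w) is e_{-t}(w), which is also a contraction. *)
Lemma group_isometry w t x : rnorm w < 1 ->
  rnorm (bderiv w (U t (mon 0%N x))) = rnorm x.
Proof.
move=> w1; apply/eqP; rewrite eq_le group_contraction//=.
have {1}-> : x = bderiv w (U (- t) (mon 0%N (bderiv w (U t (mon 0%N x))))).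
  rewrite -group_zeroth_order// -(c0_add cU) addNr (c0_id cU).
  by rewrite bderiv_mon0.
exact: group_contraction.
Qed.

Definition fiber_group t x : E := bderiv 0 (U t (mon 0%N x)).

Let rnorm0_lt1 : rnorm (0 : R[i]) < 1. Proof. by rewrite rnorm0. Qed.

(** By [group_isometry] this is a holomorphic function of w with constant norm. *)
Lemma group_fiber t x w : rnorm w < 1 -> bderiv w (U t (mon 0%N x)) = fiber_group t x.
Proof.
move=> w1; have h := holomorphic_derive nE (bloch_holomorphic (U t (mon 0%N x))).
apply: (holomorphic_cst_norm nE scE h _ w1) => z z1; exact: group_isometry.
Qed.

Lemma group_mon0 t x : U t (mon 0%N x) = mon 0%N (fiber_group t x).
Proof. by apply: bderiv_inj => w w1; rewrite group_fiber// bderiv_mon0. Qed.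

Definition fiber_operator : {linear E -> E} := bderiv 0 \o A \o mon 0%N.

Lemma fiber_curve w x t : rnorm w < 1 ->
  curve_deriv (fiber_group ^~ x) t ('i *: bderiv w (A (mon 0%N (fiber_group t x)))).
Proof.
move=> w1; rewrite -linearZ -group_mon0.
have := @curve_deriv_bounded_linear R (B0 E) E (bderiv w) _ _ _ _
  (fun f => bderiv_bounded f w1) (Ucurve (mon 0%N x) t).
by congr curve_deriv; apply/funext => s; exact: group_fiber.
Qed.

Lemma fiber_group_id x : fiber_group 0 x = x.
Proof. by rewrite /fiber_group (c0_id cU) bderiv_mon0. Qed.

(** Both sides, multiplied by i, are the derivative at 0 of t |-> u_t x. *)
Lemma fiber_operatorE w x : rnorm w < 1 ->
  bderiv w (A (mon 0%N x)) = fiber_operator x.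
Proof.
move=> w1; have c1 := fiber_curve x 0 w1; have c2 := fiber_curve x 0 rnorm0_lt1.
have : 'i *: bderiv w (A (mon 0%N x)) + (-1) *: ('i *: fiber_operator x) = 0.
  have := curve_deriv_cst (curve_derivD c1 (curve_derivZ (-1) c2)).
  rewrite fiber_group_id; apply => s; by rewrite !scaleN1r !subrr.
rewrite scaleN1r -scalerBr => /eqP; rewrite scaler_eq0 subr_eq0 => /orP[/eqP i0|/eqP//].
by have := rnorm_i (R := R); rewrite i0 rnorm0 => /eqP; rewrite eq_sym oner_eq0.
Qed.

Lemma fiber_operator_bounded x : rnorm (fiber_operator x) <= K * rnorm x.
Proof.
apply: (le_trans (bderiv_bounded _ rnorm0_lt1)).
rewrite rnorm0 expr0n subr0 invr1 mul1r; apply: (le_trans (AK _)).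
by rewrite ler_wpM2l// rnorm_mon0.
Qed.

Lemma fiber_c0_group : c0_isometry_group fiber_group.
Proof.
split.
- move=> t a x y; rewrite /fiber_group linearP (c0_linear cU) linearP.
  by [].
- by move=> t x; rewrite -!rnormE group_isometry.
- move=> t y; exists (fiber_group (- t) y).
  rewrite /fiber_group -group_mon0 -(c0_add cU) addrN (c0_id cU).
  by rewrite bderiv_mon0.
- exact: fiber_group_id.
- by move=> s t x; rewrite {1 2}/fiber_group (c0_add cU) group_mon0.
- by move=> x t; exact: curve_deriv_continuous (fiber_curve x t rnorm0_lt1).
Qed.

Lemma fiber_hermitian : hermitian_operator fiber_operator.
Proof.
exists fiber_group; first exact: fiber_c0_group.
move=> x; have := curve_deriv_generates (fiber_curve x 0 rnorm0_lt1).
by rewrite fiber_group_id.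
Qed.

(** Both functions vanish at 0 and have the same derivative. *)
Lemma operator_fiberwise f z : rnorm z < 1 -> A f z = fiber_operator (f z).
Proof.
move=> z1; pose h z := A f z + (-1) *: fiber_operator (f z).
have hd w : rnorm w < 1 -> complex_deriv h w 0.
  move=> w1; have := complex_derivD ((bloch_holomorphic (A f)).1 w w1)
    (complex_derivZ (-1) (complex_deriv_bounded_linear fiber_operator_bounded
      ((bloch_holomorphic f).1 w w1))).
  by rewrite A_zeroth_order// fiber_operatorE// scaleN1r subrr.
have := @derive1_0_cst R E h _ _ z.
rewrite /h (lb_0 (B0P (A f))) (lb_0 (B0P f)) linear0 scaler0 addr0 scaleN1r.
move=> H; apply/eqP; rewrite -subr_eq0; apply/eqP; apply: H; last by rewrite diskE.
- by move=> w /diskE /hd /complex_derivP[].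
- by move=> w /diskE /hd /complex_derivP[_]; rewrite derive1E.
Qed.

End HermitianSymbol.

Theorem corollary4p6 (R : realType) (E : completeNormedModType R[i])
    (smoothE : smooth_space E) (convE : strictly_convex_space E)
    (A : {linear B0 E -> B0 E})
    (bA : bounded_operator A) (hA : hermitian_operator A) :
  exists V : {linear E -> E},
    [/\ bounded_operator V,
        hermitian_operator V
      & forall (f : B0 E) (z : R[i]), disk z -> A f z = V (f z)].
Proof.
have nE := smooth_norming smoothE; have [K K0 AK] := ler_bounded_operator bA.
have [U cU gU] := hA; have Uc := group_curve cU gU.
exists (fiber_operator A); split.
- exists K => x; rewrite -!rnormE -rmorphM lecR.
  exact: (fiber_operator_bounded K0 AK).
- exact: (fiber_hermitian nE convE K0 AK cU Uc).
- by move=> f z /diskE; exact: (operator_fiberwise nE convE K0 AK cU Uc).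
Qed.
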